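(* Let $X_1,X_2,\dots$ be a sequence of independent real-valued random variables with means zero and finite variances $\sigma_i^2=E|X_i|^2$. Suppose that $\Sigma_\infty:=\sum_{i=1}^\infty\sigma_i^2\in(0,\infty)$ and consider the normalized series $$S_\infty=\Sigma_\infty^{-1/2}\sum_{i=1}^\infty X_i.$$ If all $X_i$ have finite third absolute moments, then $$d_W(S_\infty,N)\le 4\mathcal{L}_3(S_\infty)=4\Sigma_\infty^{-3/2}\sum_{i=1}^\infty E|X_i|^3 .$$
   Context: $N$ is a standard normal random variable. $d_W(F,N):=\sup|E[h(F)]-E[h(N)]|$, the supremum over all $h:\mathbb{R}\to\mathbb{R}$ with $|h(x)-h(y)|\le|x-y|$. For a measurable function $F=F(X)$ of the sequence $X=(X_1,X_2,\dots)$, $E_i$ denotes expectation with respect to $X_i$ only (so $E_i[F]=E[F|\sigma(X_k,k\ne i)]$), $\mathfrak{D}_iF=F-E_i[F]$, and $\mathcal{L}_r(F):=\sum_{i=1}^\infty E|\mathfrak{D}_iF|^r$, $r>0$. The bound may equal $+\infty$. *)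

(* Defs.v *)
From HB Require Import structures.
From mathcomp Require Import all_boot all_order all_algebra finmap.
From mathcomp Require Import all_classical all_reals all_analysis.

Set Implicit Arguments.
Unset Strict Implicit.
Unset Printing Implicit Defensive.

Import Order.TTheory GRing.Theory Num.Theory.
Import numFieldNormedType.Exports.

Local Open Scope classical_set_scope.
Local Open Scope ring_scope.
Local Open Scope ereal_scope.

Definition independent_RVs (d : measure_display) (T : measurableType d)
    (R : realType) (P : probability T R) (X : nat -> {RV P >-> R}) : Prop :=
  forall (I : {fset nat}) (A : nat -> set R),
    (forall i, measurable (A i)) ->
    P (\bigcap_(i in [set` I]) (X i @^-1` A i)) =
    \prod_(i <- I) P (X i @^-1` A i).

(* [Z] is a version of the conditional expectation of [F] given the
   sub-sigma-algebra [G]. *)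
Definition is_cond_exp (d : measure_display) (T : measurableType d)
    (R : realType) (P : probability T R) (G : set (set T)) (F Z : T -> R)
    : Prop :=
  [/\ forall B : set R, measurable B -> G (Z @^-1` B),
      P.-integrable [set: T] (EFin \o Z) &
      forall A, G A -> \int[P]_(w in A) (Z w)%:E = \int[P]_(w in A) (F w)%:E].

(* A version is selected by choice; for integrable [F] a version exists and any
   two agree almost surely.  The value is the junk constant 0 if there is no
   version. *)
Definition cond_exp (d : measure_display) (T : measurableType d)
    (R : realType) (P : probability T R) (G : set (set T)) (F : T -> R)
    : T -> R :=
  xget (cst 0%R) [set Z | is_cond_exp P G F Z].

(* sigma(X_k, k <> i) *)
Definition sigma_except (d : measure_display) (T : measurableType d)
    (R : realType) (X : nat -> T -> R) (i : nat) : set (set T) :=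
  <<s \bigcup_(k in [set k | k <> i])
        preimage_set_system [set: T] (X k) (@measurable _ R) >>.

Definition frakD (d : measure_display) (T : measurableType d)
    (R : realType) (P : probability T R) (X : nat -> T -> R) (i : nat)
    (F : T -> R) : T -> R :=
  fun w => (F w - cond_exp P (sigma_except X i) F w)%R.

Definition calL (d : measure_display) (T : measurableType d)
    (R : realType) (P : probability T R) (X : nat -> T -> R) (r : R)
    (F : T -> R) : \bar R :=
  \sum_(0 <= i <oo) 'E_P[fun w => (`|frakD P X i F w| `^ r)%R].

Definition wasserstein (d d' : measure_display) (T : measurableType d)
    (T' : measurableType d') (R : realType) (P : probability T R)
    (P' : probability T' R) (F : T -> R) (Y : T' -> R) : \bar R :=
  ereal_sup [set `|'E_P[h \o F] - 'E_P'[h \o Y]| | h in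
    [set h : R -> R | forall x y : R, (`|h x - h y| <= `|x - y|)%R]].

Definition Sigma_oo (d : measure_display) (T : measurableType d)
    (R : realType) (P : probability T R) (X : nat -> T -> R) : \bar R :=
  \sum_(0 <= i <oo) 'E_P[fun w => (X i w ^+ 2)%R].

(* The sum of the series is the pointwise limit of its partial sums, with an
   unspecified value where they diverge: for independent centered summands
   with summable variances this happens with probability 0. *)
Definition S_oo (d : measure_display) (T : measurableType d)
    (R : realType) (P : probability T R) (X : nat -> T -> R) : T -> R :=
  fun w => (fine (Sigma_oo P X) `^ (- (1 / 2))
            * limn (fun n => \sum_(0 <= i < n) X i w))%R.

(* Main.v *)
(** Stein's method.  With [phi] the standard normal density and [h] Lipschitz,
    [f x = (phi x)^-1 * \int_(-oo, x] (h - E h(N)) phi] solves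
    [f' x - x f x = h x - E h(N)].  If [h] is nondecreasing, then [x f x] is
    nonincreasing (a Mills ratio estimate); applied to [id + h] and [id - h]
    this shows that [x f x] is 1-Lipschitz when [h] is, whence [|f| <= 1] and
    [f'] is 2-Lipschitz.  Put [S = c W], [W = \sum_i X_i]: since [X_i] is
    independent of [W - X_i], the mean value theorem gives
    [|E (c X_i f(S)) - c^2 E X_i^2 E f'(S)| <= 4 c^3 E |X_i|^3], and summing over
    [i] yields the bound.  The series converges almost surely by Kolmogorov's
    maximal inequality and in [L^1] by Fatou's lemma. *)
Require Import Defs.
From HB Require Import structures.
From mathcomp Require Import all_boot all_order all_algebra finmap.
From mathcomp Require Import all_classical all_reals all_analysis.
From mathcomp Require Import measurable_realfun.
From mathcomp Require Import ring lra.
Set Implicit Arguments.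
Unset Strict Implicit.
Unset Printing Implicit Defensive.
Import Order.TTheory GRing.Theory Num.Theory.
Import numFieldNormedType.Exports.
Local Open Scope classical_set_scope.
Local Open Scope ring_scope.

(** For a merely Lipschitz [h] the solution of Stein's equation need not have a second derivative,
    so the Lipschitz bound on [f'] replaces it throughout. The constant 4 is 2 + 2: one 2 for the
    remainder of the first-order expansion of [f] at [S - c X_i], the other for moving [f'] from
    there back to [S], which rests on [E X_i^2 E |X_i| <= E |X_i|^3].

    The remaining difficulty is that [W] is only an almost sure limit. Where the series diverges
    [limn] has a default value, so [W - X_i] need not be measurable for the variables other than
    [X_i]; the limit of the sums that skip [X_i] takes its place and agrees with it almost surely.
    The same function is a version of the conditional expectation of [W], so [frakD] equals [c X_i]
    almost surely whichever version choice selects, and the two forms of the bound coincide.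
    Finally, no infinite sum is exchanged with an expectation: only the factor [W] in [W f(S)] is
    truncated to a partial sum, while the argument of [f] keeps the full series. *)

Section integrable_EFin.
Context d (T : measurableType d) (R : realType) (mu : {measure set T -> \bar R}).
Variables (D : set T) (mD : measurable D).
Implicit Types f g : T -> R.
Local Notation integrable f := (mu.-integrable D (EFin \o f)).

Lemma integrable_EFinZl (k : R) f : integrable f -> integrable (fun x => k * f x).
Proof. exact: integrableZl. Qed.

Lemma integrable_EFinD f g :
  integrable f -> integrable g -> integrable (fun x => f x + g x).
Proof. by move=> fi gi; exact: (integrableD mD fi gi). Qed.

Lemma integrable_EFinB f g :
  integrable f -> integrable g -> integrable (fun x => f x - g x).
Proof. by move=> fi gi; exact: (integrableB mD fi gi). Qed.

Lemma integrable_EFin_sum (I : Type) (s : seq I) (F : I -> T -> R) :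
  (forall i, integrable (F i)) -> integrable (fun x => \sum_(i <- s) F i x).
Proof.
move=> Fi; elim: s => [|i s IH].
  rewrite [X in _.-integrable _ X](_ : _ = cst 0%E); first exact: integrable0.
  by apply/funext => x /=; rewrite big_nil.
rewrite [X in _.-integrable _ X](_ : _ =
    EFin \o (fun x => F i x + \sum_(i <- s) F i x)); first exact: integrable_EFinD.
by apply/funext => x /=; rewrite big_cons.
Qed.

Lemma Rintegral_sum (I : Type) (s : seq I) (F : I -> T -> R) :
  (forall i, integrable (F i)) ->
  \int[mu]_(x in D) (\sum_(i <- s) F i x) = \sum_(i <- s) \int[mu]_(x in D) F i x.
Proof.
move=> Fi; elim: s => [|i s IH].
  under eq_Rintegral do rewrite big_nil.
  by rewrite big_nil Rintegral_cst// mul0r.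
under eq_Rintegral do rewrite big_cons.
by rewrite RintegralD ?big_cons ?IH//; exact: integrable_EFin_sum.
Qed.

Lemma le_integrable_EFin f g : measurable_fun D f ->
  (forall x, D x -> `|f x| <= g x) -> integrable g -> integrable f.
Proof.
move=> mf fg; apply: le_integrable => //; first exact/measurable_EFinP.
by move=> x Dx /=; rewrite lee_fin (le_trans (fg _ Dx))// ler_norm.
Qed.

End integrable_EFin.

(** * The standard normal density *)

Section normal01.
Context {R : realType}.
Local Notation mu := lebesgue_measure.
Local Notation phi := (@normal_pdf R 0 1).

Lemma normal01E (x : R) : phi x = normal_peak 1 * expR (- (x ^+ 2 / 2)).
Proof.
rewrite normal_pdfE ?oner_eq0// /normal_fun subr0 expr1n.
by congr (_ * expR _); rewrite mulNr.
Qed.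

Lemma normal01_gt0 (x : R) : 0 < phi x.
Proof. by rewrite normal01E mulr_gt0 ?expR_gt0// normal_peak_gt0// oner_neq0. Qed.

Lemma continuous_normal01 : continuous phi.
Proof. by apply: continuous_normal_pdf; rewrite oner_neq0. Qed.

Lemma normal01N (x : R) : phi (- x) = phi x.
Proof. by rewrite !normal01E sqrrN. Qed.

Lemma is_derive_normal01 (x : R) : is_derive x 1 phi (- x * phi x).
Proof.
have -> : phi = fun x => normal_peak 1 * expR (- (x ^+ 2 / 2)).
  by apply/funext => t; rewrite normal01E.
apply: is_derive_eq.
rewrite /GRing.scale /=.
by field.
Qed.


(** From [expR u >= 1 + u] at [u = x ^+ 2 / 2], and [1 + x ^+ 2 / 2 >= x]. This crude decay suffices
    for the limit at infinity and for the Mills ratio estimate. *)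
Lemma normal01_mul_le (x : R) : 0 < x -> x * phi x <= normal_peak 1.
Proof.
move=> x0; rewrite normal01E mulrCA ler_piMr ?normal_peak_ge0//.
rewrite expRN -ler_pdivlMr ?invr_gt0 ?expR_gt0// invrK mul1r.
apply: le_trans (expR_ge1Dx _).
have := sqr_ge0 (x - 1); nra.
Qed.

Lemma normal01_cvgy : phi x @[x --> +oo] --> (0 : R).
Proof.
apply: (@squeeze_cvgr _ _ _ _ (cst 0) (fun x => normal_peak 1 * x^-1)).
- near=> x; rewrite normal_pdf_ge0/= ler_pdivlMr;
    last by near: x; exact: nbhs_pinfty_gt.
  by rewrite mulrC; apply: normal01_mul_le; near: x; exact: nbhs_pinfty_gt.
- exact: cvg_cst.
- rewrite -[X in _ --> X](mulr0 (normal_peak 1)); apply: cvgM; first exact: cvg_cst.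
  apply/gtr0_cvgV0; last exact: cvg_id.
  by near=> x; near: x; exact: nbhs_pinfty_gt.
Unshelve. all: by end_near. Qed.

Lemma is_derive_continuous (f df : R -> R) :
  (forall x : R, is_derive x 1 f (df x)) -> continuous f.
Proof.
move=> fdf x; apply: differentiable_continuous.
by apply/derivable1_diffP; have [] := fdf x.
Qed.

Lemma klipschitz_continuous (k : R) (f : R -> R) : 0 < k ->
  (forall x y, `|f x - f y| <= k * `|x - y|) -> continuous f.
Proof.
move=> k0 fl x; apply/cvgrPdist_lt => e e0; near=> y.
apply: (le_lt_trans (fl _ _)); rewrite mulrC -ltr_pdivlMr//.
by near: y; apply: (@nbhsx_ballx _ R x); rewrite divr_gt0.
Unshelve. all: by end_near. Qed.

Lemma MVT_everywhere (f df : R -> R) (x y : R) : x <= y ->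
  (forall z : R, is_derive z 1 f (df z)) ->
  exists2 c, x <= c <= y & f y - f x = df c * (y - x).
Proof.
move=> xy fdf; have fc : {within `[x, y], continuous f}.
  exact/continuous_subspaceT/is_derive_continuous.
have [c] := MVT_segment xy (fun z _ => fdf z) fc.
by rewrite in_itv/= => cxy ?; exists c.
Qed.

Lemma is_derive_le0_nonincreasing (f df : R -> R) (x y : R) : x <= y ->
  (forall z : R, is_derive z 1 f (df z)) -> (forall z, df z <= 0) -> f y <= f x.
Proof.
move=> xy fdf df0; have [c _ fE] := MVT_everywhere xy fdf.
by rewrite -subr_le0 fE mulr_le0_ge0// subr_ge0.
Qed.

Lemma continuous_id_normal01 : continuous (fun x : R => x * phi x).
Proof.
by move=> x; apply: cvgM; [exact: cvg_id|exact: continuous_normal01].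
Qed.

(** [- phi] is an antiderivative of [x * phi x]. The improper fundamental theorem applied here needs
    a nonnegative integrand, hence the split of the line at 0. *)
Lemma integral_id_normal01_ge0 :
  (\int[mu]_(x in `[0%R, +oo[) (x * phi x)%:E = (phi 0%R)%:E)%E.
Proof.
rewrite (@ge0_continuous_FTC2y _ _ (fun x => - phi x) 0 0).
- by rewrite sub0e -EFinN opprK.
- by move=> x x0; rewrite mulr_ge0// normal_pdf_ge0.
- exact/continuous_subspaceT/continuous_id_normal01.
- by rewrite -[X in _ --> X]oppr0; apply: cvgN; exact: normal01_cvgy.
- by move=> x _; apply: derivableN; have [] := is_derive_normal01 x.
- by apply: cvgN; apply: cvg_at_right_filter; exact: continuous_normal01.
- move=> x _; rewrite derive1E deriveN; last by have [] := is_derive_normal01 x.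
  by have /@derive_val -> := is_derive_normal01 x; rewrite mulNr opprK.
Qed.

Lemma integral_id_normal01_le0 :
  (\int[mu]_(x in `]-oo, 0%R]) (- (x * phi x))%:E = (phi 0%R)%:E)%E.
Proof.
rewrite -{1}[0%R]oppr0 ge0_integration_by_substitutionNy.
- rewrite -integral_id_normal01_ge0; apply: eq_integral => x _ /=.
  by rewrite normal01N mulNr opprK.
- apply: continuous_subspaceT => x; apply: cvgN; exact: continuous_id_normal01.
- move=> x; rewrite in_itv/= oppr0 => x0.
  by rewrite oppr_ge0 mulr_le0_ge0 ?normal_pdf_ge0// ltW.
Qed.

Lemma measurable_id_normal01 (D : set R) : measurable_fun D (fun x => x * phi x).
Proof.
by apply: measurable_funTS; apply: continuous_measurable_fun; exact: continuous_id_normal01.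
Qed.


Lemma setT_itvNyy (x : R) : [set: R] = `]-oo, x] `|` `]x, +oo[.
Proof.
apply/seteqP; split => // y _ /=; rewrite !in_itv/= andbT.
by case: (leP y x) => ?; [left|right].
Qed.

Lemma disjoint_itvNyy (x : R) : [disjoint `]-oo, x] & `]x, +oo[].
Proof.
apply/disj_setPRL => y /=; rewrite !in_itv/= andbT => xy.
by apply/negP; rewrite -ltNge.
Qed.

Lemma integrable_id_normal01 : mu.-integrable setT (EFin \o (fun x => x * phi x)).
Proof.
have mid : measurable_fun setT (fun x : R => `|(x * phi x)%:E|)%E.
  by apply: measurableT_comp => //; apply/measurable_EFinP; exact: measurable_id_normal01.
apply/integrableP; split; first by apply/measurable_EFinP; exact: measurable_id_normal01.
rewrite /comp (setT_itvNyy 0) ge0_integral_setU//=; last 2 first.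
- by rewrite -setT_itvNyy.
- exact: disjoint_itvNyy.
rewrite [X in (X + _)%E](_ : _ = (phi 0%R)%:E); last first.
  rewrite -integral_id_normal01_le0; apply: eq_integral => x /[!inE]/=.
  rewrite in_itv/= => x0; rewrite ler0_norm// mulr_le0_ge0// normal_pdf_ge0//.
rewrite [X in (_ + X)%E](_ : _ = (phi 0%R)%:E) ?ltry//.
rewrite -integral_id_normal01_ge0 -[RHS]integral_itv_obnd_cbnd; last first.
  by apply/measurable_EFinP; exact: measurable_id_normal01.
apply: eq_integral => x /[!inE]/=; rewrite in_itv/= andbT => x0.
by rewrite ger0_norm// mulr_ge0 ?normal_pdf_ge0// ltW.
Qed.

Lemma Rintegral_normal01_split (f : R -> R) (x : R) :
  mu.-integrable setT (EFin \o f) ->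
  \int[mu]_t f t = \int[mu]_(t in `]-oo, x]) f t + \int[mu]_(t in `]x, +oo[) f t.
Proof.
move=> fi; rewrite (setT_itvNyy x) Rintegral_setU// -?setT_itvNyy//.
exact: disjoint_itvNyy.
Qed.

Lemma is_derive_integralNy (f : R -> R) (x : R) : continuous f ->
  mu.-integrable setT (EFin \o f) ->
  is_derive x 1 (fun y => \int[mu]_(t in `]-oo, y]) f t) (f x).
Proof.
move=> cf fi; have [||||dF F'] := @continuous_FTC1 R f -oo%O x (x + 1).
- by rewrite ltrDl.
- exact: integrableS fi.
- by rewrite ltNyr.
- exact: cf.
- by apply: DeriveDef => //; rewrite -derive1E.
Qed.

(** The function [D] has derivative 0 everywhere and vanishes at 0 by the half-line integral, so it
    is identically 0. *)
Lemma Rintegral_id_normal01Ny (x : R) :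
  \int[mu]_(t in `]-oo, x]) (t * phi t) = - phi x.
Proof.
pose D x := \int[mu]_(t in `]-oo, x]) (t * phi t) + phi x.
have dD (y : R) : is_derive y 1 D 0.
  have d1 := is_derive_integralNy y continuous_id_normal01 integrable_id_normal01.
  have d2 := is_derive_normal01 y.
  by apply: is_derive_eq; ring.
have D0 : D 0 = 0.
  rewrite /D; apply/eqP; rewrite addr_eq0 -[X in _ == - X]/(fine (phi 0)%:E).
  rewrite -integral_id_normal01_le0; apply/eqP.
  under [X in fine X]eq_integral do rewrite -mulN1r.
  rewrite -/(Rintegral _ _ _) RintegralZl ?mulN1r ?opprK//.
  exact: integrableS integrable_id_normal01.
have DE y z : y <= z -> D z = D y.
  move=> yz; have [c _] := MVT_everywhere yz dD.
  by rewrite mul0r => /eqP; rewrite subr_eq0 => /eqP.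
apply/eqP; rewrite -addr_eq0 -/(D x); apply/eqP; rewrite -D0.
by case: (leP x 0) => [/DE //|/ltW/DE].
Qed.

Lemma Rintegral_id_normal01 : \int[mu]_t (t * phi t) = 0.
Proof.
rewrite (Rintegral_normal01_split 0 integrable_id_normal01) Rintegral_id_normal01Ny.
rewrite Rintegral_itv_obnd_cbnd; last exact: integrableS integrable_id_normal01.
by rewrite /Rintegral integral_id_normal01_ge0/= addNr.
Qed.

(** [D], the right-hand side minus the left-hand side, is nonincreasing, while its subtracted term
    tends to 0 at infinity. A negative value would therefore persist to the right and contradict the
    positivity of the tail. *)
Lemma mills_ratio_ge (x : R) :
  x / (1 + x ^+ 2) * phi x <= \int[mu]_(t in `]x, +oo[) phi t.
Proof.
have phii : mu.-integrable setT (EFin \o phi) by exact: integrable_normal_pdf.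
pose D x := \int[mu]_t phi t - \int[mu]_(t in `]-oo, x]) phi t - x * (1 + x ^+ 2)^-1 * phi x.
have DE y : D y = \int[mu]_(t in `]y, +oo[) phi t - y / (1 + y ^+ 2) * phi y.
  rewrite /D (Rintegral_normal01_split y)//. ring.
rewrite -subr_ge0 -DE leNgt; apply/negP => Dx0.
have n0 y : 1 + y ^+ 2 != 0 :> R by rewrite gt_eqF// ltr_wpDr ?sqr_ge0.
have dD (y : R) : is_derive y 1 D (- (2 / (1 + y ^+ 2) ^+ 2 * phi y)).
  have d1 := is_derive_integralNy y continuous_normal01 phii.
  have d2 := is_derive_normal01 y.
  have d3 : is_derive y 1 (fun y => (1 + y ^+ 2)^-1) (- (1 + y ^+ 2) ^- 2 *: (2 * y)).
    apply: is_deriveV; first exact: n0.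
    by apply: is_derive_eq; rewrite /GRing.scale/=; ring.
  apply: is_derive_eq; rewrite /GRing.scale/=.
  by field.
(* At this [y] one has [normal_peak 1 < - D x * (1 + y ^+ 2)], while [normal01_mul_le] bounds
   [y * phi y] by [normal_peak 1]; the entry [x + 1] puts [y] to the right of [x]. *)
pose y := Num.max (x + 1) (Num.max 1 (normal_peak 1 * 2 / - D x)).
have xy : x <= y by rewrite /y le_max lerDl ler01.
have y1 : 1 <= y by rewrite /y !le_max lexx orbT.
have yD : normal_peak 1 * 2 / - D x <= y by rewrite /y !le_max lexx !orbT.
have Dyx : D y <= D x.
  apply: is_derive_le0_nonincreasing xy dD _ => z.
  by rewrite oppr_le0 mulr_ge0 ?normal_pdf_ge0// divr_ge0// sqr_ge0.
have : - D x <= y / (1 + y ^+ 2) * phi y.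
  rewrite -lerN2 opprK; apply: le_trans Dyx.
  rewrite DE lerDr; apply: Rintegral_ge0 => t _; exact: normal_pdf_ge0.
apply/negP; rewrite -ltNge.
have y0 : 0 < y by lra.
rewrite mulrAC ltr_pdivrMr ?ltr_wpDr ?sqr_ge0//.
apply: (le_lt_trans (normal01_mul_le y0)).
move: yD; rewrite ler_pdivrMr; last by rewrite oppr_gt0.
have : 0 < normal_peak 1 :> R by rewrite normal_peak_gt0// oner_neq0.
nra.
Qed.

End normal01.

(** * Stein's equation *)

Section stein.
Context {R : realType}.
Local Notation mu := lebesgue_measure.
Local Notation phi := (@normal_pdf R 0 1).

(** For any continuous [h] integrable against [phi] this solves [f' - x f = h]; it stays bounded at
    [+oo] only when [h] has Gaussian mean 0, so [stein_equation] applies it to [h - c]. *)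
Definition stein (h : R -> R) (x : R) : R :=
  (phi x)^-1 * \int[mu]_(t in `]-oo, x]) (h t * phi t).

Lemma lipschitz1_continuous (h : R -> R) :
  (forall x y, `|h x - h y| <= `|x - y|) -> continuous h.
Proof.
move=> hl; apply: (@klipschitz_continuous _ 1) => // x y.
by rewrite mul1r.
Qed.

Lemma continuous_mul_normal01 (h : R -> R) : continuous h ->
  continuous (fun x => h x * phi x).
Proof.
by move=> ch x; apply: cvgM; [exact: ch|exact: continuous_normal01].
Qed.

Lemma is_derive_stein (h : R -> R) (x : R) : continuous h ->
  mu.-integrable setT (EFin \o (fun t => h t * phi t)) ->
  is_derive x 1 (stein h) (h x + x * stein h x).
Proof.
move=> ch hi.
have p0 : phi x != 0 by rewrite gt_eqF// normal01_gt0.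
have d1 := is_derive_integralNy x (continuous_mul_normal01 ch) hi.
have d2 := is_deriveV p0 (is_derive_normal01 x).
apply: is_derive_eq; rewrite /stein /GRing.scale/=.
by field.
Qed.

Lemma stein_le_left (h : R -> R) (x : R) :
    (forall x y, x <= y -> h x <= h y) ->
    mu.-integrable setT (EFin \o (fun t => h t * phi t)) ->
  phi x * stein h x <= h x * \int[mu]_(t in `]-oo, x]) phi t.
Proof.
move=> hnd hi; have p0 : phi x != 0 by rewrite gt_eqF// normal01_gt0.
have phii : mu.-integrable `]-oo, x] (EFin \o phi).
  by apply: integrableS (integrable_normal_pdf 0 1).
rewrite /stein mulVKf// -RintegralZl//; apply: le_Rintegral => //.
- exact: integrableS hi.
- exact: integrable_EFinZl.
- move=> t /=; rewrite in_itv/= => tx.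
  by apply: ler_wpM2r; [exact: normal_pdf_ge0|exact: hnd].
Qed.

(** Mean 0 turns the integral up to [x] into minus the integral beyond [x], where [h t >= h x]. *)
Lemma stein_le_right (h : R -> R) (x : R) :
    (forall x y, x <= y -> h x <= h y) ->
    mu.-integrable setT (EFin \o (fun t => h t * phi t)) ->
    \int[mu]_t (h t * phi t) = 0 ->
  phi x * stein h x <= - h x * \int[mu]_(t in `]x, +oo[) phi t.
Proof.
move=> hnd hi h0; have p0 : phi x != 0 by rewrite gt_eqF// normal01_gt0.
have phii : mu.-integrable `]x, +oo[ (EFin \o phi).
  by apply: integrableS (integrable_normal_pdf 0 1).
rewrite /stein mulVKf//.
move: h0; rewrite (Rintegral_normal01_split x hi) => /eqP; rewrite addr_eq0 => /eqP ->.
rewrite mulNr lerN2 -RintegralZl//; apply: le_Rintegral => //.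
- exact: integrable_EFinZl.
- exact: integrableS hi.
- move=> t /=; rewrite in_itv/= andbT => tx.
  by apply: ler_wpM2r; [exact: normal_pdf_ge0|exact/hnd/ltW].
Qed.

Lemma mills_ratioNy_ge (x : R) :
  - x / (1 + x ^+ 2) * phi x <= \int[mu]_(t in `]-oo, x]) phi t.
Proof.
have := mills_ratio_ge (- x); rewrite normal01N sqrrN => /le_trans; apply.
rewrite /Rintegral.
rewrite -{2}(opprK x) ge0_integration_by_substitutionNy.
- under [X in (_ <= fine X)]eq_integral do rewrite /= normal01N.
  rewrite integral_itv_obnd_cbnd//.
  by apply/measurable_EFinP/measurable_funTS; exact: measurable_normal_pdf.
- by apply: continuous_subspaceT; exact: continuous_normal01.
- by move=> ? _; exact: normal_pdf_ge0.
Qed.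

(* [(x f)' = (1 + x ^ 2) f + x h] for the solution [f] of Stein's equation;
   monotonicity bounds [f] by [h x] times a Gaussian tail on either side. *)
Lemma stein_nondecreasing (h : R -> R) (x y : R) : continuous h ->
    (forall x y, x <= y -> h x <= h y) ->
    mu.-integrable setT (EFin \o (fun t => h t * phi t)) ->
    \int[mu]_t (h t * phi t) = 0 -> x <= y ->
  y * stein h y <= x * stein h x.
Proof.
move=> ch hnd hi h0 xy.
apply: (@is_derive_le0_nonincreasing _ (fun x => x * stein h x)
  (fun x => (1 + x ^+ 2) * stein h x + x * h x) _ _ xy).
  move=> z; have d1 := is_derive_stein z ch hi.
  by apply: is_derive_eq; rewrite /GRing.scale/=; ring.
move=> z; have p0 : 0 < phi z by rewrite normal01_gt0.
rewrite -(pmulr_rle0 _ p0).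
have q0 : 0 < 1 + z ^+ 2 by rewrite ltr_wpDr ?sqr_ge0.
have := stein_le_left z hnd hi; have := stein_le_right z hnd hi h0.
move: (stein h z) => S s1 s2.
have := mills_ratio_ge z; have := mills_ratioNy_ge z.
rewrite mulrAC ler_pdivrMr// => m1.
rewrite mulrAC ler_pdivrMr// => m2.
set I := Rintegral _ _ _ in m2 s1; set J := Rintegral _ _ _ in m1 s2.
rewrite (_ : phi z * (_ + _) = (1 + z ^+ 2) * (phi z * S) + z * h z * phi z); last by ring.
(* For [h z >= 0] the upper-tail bound is used and for [h z < 0] the lower-tail one: multiplied by
   [|h z|], the matching Mills estimate dominates [z * h z * phi z]. *)
case: (leP 0 (h z)) => hz.
  apply: (@le_trans _ _ ((1 + z ^+ 2) * (- h z * I) + z * h z * phi z)).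
    by rewrite lerD2r ler_pM2l.
  nra.
apply: (@le_trans _ _ ((1 + z ^+ 2) * (h z * J) + z * h z * phi z)).
  by rewrite lerD2r ler_pM2l.
nra.
Qed.

Lemma lipschitz1_mul_normal01_integrable (h : R -> R) :
  (forall x y, `|h x - h y| <= `|x - y|) ->
  mu.-integrable setT (EFin \o (fun t => h t * phi t)).
Proof.
move=> hl; have ch := lipschitz1_continuous hl.
pose g t := `|h 0| * phi t + `|t * phi t|.
have gi : mu.-integrable setT (EFin \o g).
  apply: integrable_EFinD => //.
    by apply: integrable_EFinZl => //; exact: integrable_normal_pdf.
  by apply: integrable_norm; exact: integrable_id_normal01.
apply: (le_integrable_EFin measurableT _ _ gi).
- apply: continuous_measurable_fun.
  exact: continuous_mul_normal01.
- move=> t _ /=; rewrite /g !normrM (ger0_norm (normal_pdf_ge0 _ _ _)) -mulrDl.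
  apply: ler_wpM2r; first exact: normal_pdf_ge0.
  rewrite -[X in `|X|](subrK (h 0)) addrC.
  apply: le_trans (ler_normD _ _) _; rewrite lerD2l.
  by apply: le_trans (hl _ _) _; rewrite subr0.
Qed.


(** The identity function has Stein solution [- 1], because the integral of [t * phi t] up to [x] is
    [- phi x]. Through this, monotonicity for [id + h] becomes a slope bound for [x * stein h x]. *)
Lemma stein_add_id (h : R -> R) (x : R) :
    mu.-integrable setT (EFin \o (fun t => h t * phi t)) ->
  stein (fun t => t + h t) x = - 1 + stein h x.
Proof.
move=> hi; rewrite /stein.
under eq_Rintegral do rewrite mulrDl.
rewrite RintegralD//; last 2 first.
- exact: integrableS integrable_id_normal01.
- exact: integrableS hi.
rewrite Rintegral_id_normal01Ny mulrDr mulrN mulVf//.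
by rewrite gt_eqF// normal01_gt0.
Qed.

Lemma steinN (h : R -> R) (x : R) :
    mu.-integrable setT (EFin \o (fun t => h t * phi t)) ->
  stein (fun t => - h t) x = - stein h x.
Proof.
move=> hi; rewrite /stein -mulrN ; congr (_ * _).
under eq_Rintegral do rewrite mulNr -mulN1r.
by rewrite RintegralZl ?mulN1r//; exact: integrableS hi.
Qed.

Lemma le_mul_stein (h : R -> R) (x y : R) :
    (forall x y, `|h x - h y| <= `|x - y|) ->
    \int[mu]_t (h t * phi t) = 0 -> x <= y ->
  y * stein h y - x * stein h x <= y - x.
Proof.
move=> hl h0 xy; have hi := lipschitz1_mul_normal01_integrable hl.
have ch := lipschitz1_continuous hl.
have : y * stein (fun t => t + h t) y <= x * stein (fun t => t + h t) x.
  apply: stein_nondecreasing => //.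
  - by move=> z; apply: cvgD; [exact: cvg_id|exact: ch].
  - move=> a b ab; have := hl a b; rewrite ler_norml distrC ger0_norm ?subr_ge0//.
    lra.
  - rewrite (_ : (fun t => _) = (fun t => t * phi t + h t * phi t)).
      by apply: integrable_EFinD => //; exact: integrable_id_normal01.
    by apply/funext => t; rewrite mulrDl.
  - under eq_Rintegral do rewrite mulrDl.
    by rewrite RintegralD// ?h0 ?Rintegral_id_normal01 ?addr0//; exact: integrable_id_normal01.
by rewrite !stein_add_id//; lra.
Qed.

Lemma lipschitz_mul_stein (h : R -> R) (x y : R) :
    (forall x y, `|h x - h y| <= `|x - y|) ->
    \int[mu]_t (h t * phi t) = 0 ->
  `|y * stein h y - x * stein h x| <= `|y - x|.
Proof.
move=> hl h0; wlog xy : x y / x <= y.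
  move=> H; case: (leP x y) => [/H//|/ltW/H].
  by rewrite distrC (distrC y).
rewrite (ger0_norm (_ : 0 <= y - x)) ?subr_ge0// ler_norml le_mul_stein// andbT.
have hi := lipschitz1_mul_normal01_integrable hl.
have := @le_mul_stein (fun t => - h t) x y _ _ xy; rewrite !steinN//.
rewrite lerNl opprB => H.
have -> : x * stein h x - y * stein h y = y * - stein h y - x * - stein h x by ring.
apply: H.
- by move=> a b; rewrite -opprD normrN.
- under eq_Rintegral do rewrite mulNr -mulN1r.
  by rewrite RintegralZl// h0 mulr0.
Qed.

(** The 1-Lipschitz function [x * stein h x] vanishes at 0, so its absolute value is at most [|x|];
    dividing by [|x|] leaves out [x = 0], where continuity takes over. *)
Lemma stein_bounded (h : R -> R) (x : R) :
    (forall x y, `|h x - h y| <= `|x - y|) ->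
    \int[mu]_t (h t * phi t) = 0 ->
  `|stein h x| <= 1.
Proof.
move=> hl h0; have hi := lipschitz1_mul_normal01_integrable hl.
have ch := lipschitz1_continuous hl.
have B (y : R) : y != 0 -> `|stein h y| <= 1.
  move=> y0; have := lipschitz_mul_stein 0 y hl h0.
  by rewrite mul0r !subr0 normrM -[leRHS]mulr1 ler_pM2l// normr_gt0.
have [->|] := eqVneq x 0; last exact: B.
have cs : {for 0, continuous (stein h)}.
  by apply: is_derive_continuous => z; exact: is_derive_stein.
rewrite leNgt; apply/negP => s1.
have : \forall y \near (0:R), 1 < `|stein h y|.
  have : `|stein h y| @[y --> (0:R)] --> `|stein h 0| by apply: cvg_norm; exact: cs.
  by move/cvgr_gt; apply.
case/nbhs_ballP => e /= e0 /(_ (e / 2)).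
rewrite /ball/= sub0r normrN gtr0_norm ?divr_gt0// ltr_pdivrMr// ltr_pMr// ltr1n => /(_ isT).
by apply/negP; rewrite -leNgt B// gt_eqF// divr_gt0.
Qed.

(** [f'] is the sum of the 1-Lipschitz functions [h - c] and [x * f x], whence the factor 2. For the
    bound 4, some point of [[x, x + 1]] has [f'] equal to [f (x + 1) - f x], at most 2 in absolute
    value, and the Lipschitz bound adds at most 2 on the way to [x]. This bound serves
    integrability; the 4 of the theorem arises in [stein_step]. *)
Lemma stein_equation (h : R -> R) (c : R) :
    (forall x y, `|h x - h y| <= `|x - y|) ->
    c = \int[mu]_t (h t * phi t) ->
  exists f f' : R -> R,
    [/\ forall x : R, is_derive x 1 f (f' x),
        forall x, `|f x| <= 1,
        forall x, `|f' x| <= 4,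
        forall x y, `|f' x - f' y| <= 2 * `|x - y| &
        forall x, f' x - x * f x = h x - c].
Proof.
move=> hl cE; pose g x := h x - c.
have gl x y : `|g x - g y| <= `|x - y|.
  by rewrite /g opprB addrA subrK.
have hi := lipschitz1_mul_normal01_integrable hl.
have g0 : \int[mu]_t (g t * phi t) = 0.
  under eq_Rintegral do rewrite mulrBl.
  have phii : mu.-integrable setT (EFin \o phi) by exact: integrable_normal_pdf.
  rewrite RintegralB//; last exact: integrable_EFinZl.
  by rewrite RintegralZl// -cE /Rintegral integral_normal_pdf/= mulr1 subrr.
have gi := lipschitz1_mul_normal01_integrable gl.
have cg := lipschitz1_continuous gl.
pose f' x := g x + x * stein g x.
have df (x : R) : is_derive x 1 (stein g) (f' x) by exact: is_derive_stein.
have f'l x y : `|f' x - f' y| <= 2 * `|x - y|.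
  rewrite /f' opprD addrACA mulr_natl mulr2n; apply: le_trans (ler_normD _ _) _.
  by apply: lerD => //; exact: lipschitz_mul_stein.
have sb x : `|stein g x| <= 1 by exact: stein_bounded.
exists (stein g), f'; split => //; last by move=> x; rewrite /f' addrK.
move=> x; have xx1 : x <= x + 1 by rewrite lerDl.
have [c' /andP[xc cx] ] := MVT_everywhere xx1 df.
rewrite addrAC subrr add0r mulr1 => E.
have := f'l x c'; have := sb x; have := sb (x + 1).
rewrite -E (distrC x) (ger0_norm (_ : 0 <= c' - x)) ?subr_ge0//.
rewrite !ler_norml; lra.
Qed.

End stein.

(** * Independence *)

Section product_expectation.
Context d (T : measurableType d) (R : realType) (P : probability T R).

(** Independence on rectangles makes the law of the pair [(U, V)] the product of the two laws, by
    uniqueness of the product measure; Tonelli gives integrability of the product and Fubini its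
    value. *)
Lemma Rintegral_mul_indep (U V : T -> R) :
    P.-integrable setT (EFin \o U) -> P.-integrable setT (EFin \o V) ->
    (forall A B, measurable A -> measurable B ->
      P (U @^-1` A `&` V @^-1` B) = P (U @^-1` A) * P (V @^-1` B))%E ->
  P.-integrable setT (EFin \o (fun w => U w * V w)) /\
  \int[P]_w (U w * V w) = \int[P]_w U w * \int[P]_w V w.
Proof.
move=> Ui Vi UV.
have mU : measurable_fun setT U by apply/measurable_EFinP; exact: measurable_int Ui.
have mV : measurable_fun setT V by apply/measurable_EFinP; exact: measurable_int Vi.
have mUV : measurable_fun setT (fun w => (U w, V w)) by exact: measurable_fun_pair.
pose U' : {mfun T >-> R} := mfun_Sub (mem_set mU : U \in mfun).
pose V' : {mfun T >-> R} := mfun_Sub (mem_set mV : V \in mfun).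
pose UV' : {mfun T >-> (R * R)%type} := mfun_Sub (mem_set mUV : (fun w => (U w, V w)) \in mfun).
pose m1 := distribution P U'; pose m2 := distribution P V'.
pose m' := distribution P UV'.
have m'E A : measurable A -> (m1 \x m2)%E A = m' A.
  apply: product_measure_unique => B C mB mC.
  rewrite /m' /m1 /m2 /distribution /pushforward /= -UV//.
pose f (z : R * R) : \bar R := (z.1 * z.2)%:E.
have mf : measurable_fun setT f.
  by apply/measurable_EFinP; apply: measurable_funM; [exact: measurable_fst|exact: measurable_snd].
have U1 : (\int[m1]_x `|x%:E| < +oo)%E.
  rewrite ge0_integral_distribution//=; last by apply: measurableT_comp => //; exact: measurable_EFin.
  by have /integrableP[_] := Ui.
have V1 : (\int[m2]_x `|x%:E| < +oo)%E.
  rewrite ge0_integral_distribution//=; last by apply: measurableT_comp => //; exact: measurable_EFin.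
  by have /integrableP[_] := Vi.
have mabs : measurable_fun setT (fun x : R => `|x%:E|)%E.
  by apply: measurableT_comp => //; exact: measurable_EFin.
have fi : (m1 \x m2)%E.-integrable setT f.
  apply/integrable12ltyP => //.
  rewrite (_ : (fun x => _) = (fun x => (\int[m2]_y `|y%:E|) * `|x%:E|)%E); last first.
    apply/funext => x; rewrite muleC -ge0_integralZl//.
    by apply: eq_integral => y _; rewrite /f EFinM abseM.
  rewrite ge0_integralZl//; last exact: integral_ge0.
  by rewrite lte_mul_pinfty//; [exact: integral_ge0|
    rewrite ge0_fin_numE//; exact: integral_ge0].
have fi' : m'.-integrable setT f.
  apply/integrableP; split => //; have /integrableP[_] := fi.
  rewrite (eq_measure_integral m')// => A mA _; exact: m'E.
have UVi : P.-integrable setT (EFin \o (fun w => U w * V w)).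
  apply/integrableP; split; first by apply/measurable_EFinP; exact: measurable_funM.
  have /integrableP[_] := fi'.
  by rewrite ge0_integral_distribution//; exact: measurableT_comp.
split => //.
have UVE : (\int[P]_w (U w * V w)%:E = \int[(m1 \x m2)%E]_z f z)%E.
  transitivity (\int[m']_z f z)%E; first by rewrite integral_distribution.
  by apply: eq_measure_integral => A mA _; apply/esym; exact: m'E.
have Vm2 : (\int[m2]_y y%:E = \int[P]_w (V w)%:E)%E.
  by rewrite integral_distribution//; exact: measurable_EFin.
have Um1 : (\int[m1]_y y%:E = \int[P]_w (U w)%:E)%E.
  by rewrite integral_distribution//; exact: measurable_EFin.
have im1 : m1.-integrable setT EFin.
  by apply/integrableP; split => //; exact: measurable_EFin.
have im2 : m2.-integrable setT EFin.
  by apply/integrableP; split => //; exact: measurable_EFin.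
rewrite /Rintegral -fineM ?integrable_fin_num// UVE -integral12_prod_meas1//.
congr fine; rewrite /fubini_F.
have FE (x : R) : (\int[m2]_y f (x, y) = x%:E * (\int[P]_w V w)%:E)%E.
  rewrite /Rintegral fineK ?integrable_fin_num// -Vm2 -integralZl//.
transitivity (\int[m1]_x (x%:E * (\int[P]_w V w)%:E))%E.
  by apply: eq_integral => x _; exact: FE.
by rewrite integralZr// Um1 /Rintegral fineK ?integrable_fin_num.
Qed.


End product_expectation.

Section indep_sigma_except.
Context d (T : measurableType d) (R : realType) (P : probability T R).
Variable X : nat -> {RV P >-> R}.
Hypothesis X_indep : independent_RVs X.

Lemma sigma_except_measurable i A : sigma_except X i A -> measurable A.
Proof.
apply: smallest_sub; first exact: sigma_algebra_measurable.
by move=> B [k _ [C mC <-]]; rewrite setTI; exact: measurable_funPTI.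
Qed.

(* A pi-system generating [sigma_except X i]. *)
Let cyl (i : nat) : set (set T) := [set A | exists (I : {fset nat}) (B : nat -> set R),
  [/\ i \notin I, forall k, measurable (B k) &
      A = \bigcap_(k in [set` I]) (X k @^-1` B k)]].

Let cylI i : setI_closed (cyl i).
Proof.
move=> _ _ [I [B [iI mB ->]]] [J [C [iJ mC ->]]].
exists (I `|` J)%fset, (fun k => (if k \in I then B k else setT) `&`
  (if k \in J then C k else setT)).
split.
- by rewrite in_fsetU negb_or iI.
- by move=> k; apply: measurableI; case: ifP.
- apply/seteqP; split => [w [wI wJ] k /=|w H].
    rewrite in_fsetU => _; split; case: ifP => // kI; [exact: wI|exact: wJ].
  split => k /= kI.
    have [] := H k; first by rewrite /= in_fsetU kI.
    by rewrite kI.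
  have [] := H k; first by rewrite /= in_fsetU kI orbT.
  by rewrite kI.
Qed.

(** Dynkin argument: for fixed [B] the events [A] that satisfy the equation form a Dynkin system,
    and it contains the cylinders [cyl i], which are closed under intersection and generate
    [sigma_except X i]. *)
Lemma indep_sigma_except i (A : set T) (B : set R) :
  sigma_except X i A -> measurable B ->
  P (X i @^-1` B `&` A) = (P (X i @^-1` B) * P A)%E.
Proof.
move=> GA mB; have mXB : measurable (X i @^-1` B) by exact: measurable_funPTI.
pose D := [set A | measurable A /\ P (X i @^-1` B `&` A) = (P (X i @^-1` B) * P A)%E].
suff : D A by case.
have dD : dynkin D.
  split.
  - split; first exact: measurableT.
    by rewrite setIT probability_setT mule1.
  - move=> C [mC CE]; split; first exact: measurableC.
    rewrite -setDE measureD//; last by rewrite -ge0_fin_numE// fin_num_measure.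
    transitivity (P (X i @^-1` B) - P (X i @^-1` B) * P C)%E; first by congr (_ - _)%E.
    by rewrite probability_setC// muleBr ?mule1// ?fin_num_measure// fin_num_adde_defr.
  - move=> F tF DF; have mF n : measurable (F n) by case: (DF n).
    split; first exact: bigcup_measurable.
    rewrite setI_bigcupr !measure_bigcup//; last 2 first.
    - by move=> n _; exact: measurableI.
    - exact: trivIset_setIl.
    rewrite -[P (X i @^-1` B)]fineK ?fin_num_measure// -nneseriesZl//.
    by apply: eq_eseriesr => n _; rewrite fineK ?fin_num_measure//; case: (DF n).
suff : <<s cyl i >> A.
  rewrite -setI_closed_g_dynkin_g_sigma_algebra//.
  apply: smallest_sub => // _ [I [C [iI mC ->]]].
  split; first by apply: bigcap_measurableType => k _; exact: measurable_funPTI.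
  (* Putting [B] at the index [i] merges the two events into one cylinder over [i] and [I], to which
     joint independence applies; since [i] is not in [I], nothing else changes. *)
  pose E k := if k == i then B else C k.
  have mE k : measurable (E k) by rewrite /E; case: ifP.
  have EI : \bigcap_(k in [set` I]) (X k @^-1` E k) = \bigcap_(k in [set` I]) (X k @^-1` C k).
    apply: eq_bigcapr => k /= kI; rewrite /E; case: eqP => // ki.
    by move: kI iI; rewrite ki => ->.
  rewrite (_ : _ `&` _ = \bigcap_(k in [set` (i |` I)%fset]) (X k @^-1` E k)); last first.
    by rewrite bigcap_fsetU1 EI {1}/E eqxx.
  rewrite X_indep// big_fsetU1//=.
  by rewrite -EI X_indep// {1}/E eqxx.
apply: smallest_sub A GA; first exact: smallest_sigma_algebra.
move=> _ [k /= ki [C mC <-]]; rewrite setTI; apply: sub_gen_smallest.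
exists [fset k]%fset, (fun=> C); split => //.
  by rewrite inE eq_sym; apply/eqP.
apply/seteqP; split => [w Cw j|w]; first by rewrite /= inE => /eqP ->.
by apply; rewrite /= inE.
Qed.

(** Literally the measurability clause of [is_cond_exp], so that any version satisfies it at once;
    [sigma_except_fun_meas] supplies it from measurability for the generated sigma-algebra, where
    the usual closure lemmas hold. *)
Definition sigma_except_fun i (Y : T -> R) :=
  forall B : set R, measurable B -> sigma_except X i (Y @^-1` B).

Lemma sigma_except_funP i (Y : T -> R) : sigma_except_fun i Y ->
  measurable_fun setT Y.
Proof.
by move=> GY _ B mB; rewrite setTI; apply: sigma_except_measurable; exact: GY.
Qed.

Lemma Rintegral_mul_sigma_except i (g : R -> R) (Y : T -> R) :
    measurable_fun setT g -> P.-integrable setT (EFin \o (g \o X i)) ->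
    sigma_except_fun i Y -> P.-integrable setT (EFin \o Y) ->
  P.-integrable setT (EFin \o (fun w => g (X i w) * Y w)) /\
  \int[P]_w (g (X i w) * Y w) = \int[P]_w g (X i w) * \int[P]_w Y w.
Proof.
move=> mg gi GY Yi; apply: (@Rintegral_mul_indep _ _ _ _ (g \o X i) Y) => // A B mA mB.
rewrite comp_preimage; apply: indep_sigma_except; first exact: GY.
by rewrite -[X in measurable X]setTI; exact: mg.
Qed.

Lemma sigma_except_fun_meas i (Y : T -> R) :
  measurable_fun (setT : set (g_sigma_algebraType
    (\bigcup_(k in [set k | k <> i]) preimage_set_system [set: T] (X k) (@measurable _ R)))) Y ->
  sigma_except_fun i Y.
Proof. by move=> mY B mB; have := mY measurableT B mB; rewrite setTI. Qed.

Lemma measurable_fun_sigma_except i k : k != i ->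
  measurable_fun (setT : set (g_sigma_algebraType
    (\bigcup_(k in [set k | k <> i]) preimage_set_system [set: T] (X k) (@measurable _ R)))) (X k).
Proof.
move=> ki _ B mB; apply: sub_sigma_algebra; exists k; first exact/eqP.
by exists B.
Qed.

End indep_sigma_except.

Section square_integrable.
Context d (T : measurableType d) (R : realType) (P : probability T R).
Implicit Types f g : T -> R.
Local Notation integrable f := (P.-integrable setT (EFin \o f)).

Lemma integrable_cst_prob (k : R) : integrable (fun=> k).
Proof. exact: finite_measure_integrable_cst. Qed.

Lemma Rintegral_cst_prob (k : R) : \int[P]__ k = k.
Proof. by rewrite /Rintegral integral_cst//= probability_setT mule1. Qed.

Lemma integrable_sqr_integrable f : measurable_fun setT f ->
  integrable (fun w => f w ^+ 2) -> integrable f.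
Proof.
move=> mf f2; apply: (@le_integrable_EFin _ _ _ _ _ measurableT f (fun w => 1 + f w ^+ 2)) => //.
  move=> w _; rewrite -(real_normK (num_real (f w))).
  by have := sqr_ge0 (`|f w| - 1); have := normr_ge0 (f w); nra.
by apply: integrable_EFinD => //; exact: integrable_cst_prob.
Qed.

Lemma integrable_mul_sqr f g : measurable_fun setT f -> measurable_fun setT g ->
  integrable (fun w => f w ^+ 2) -> integrable (fun w => g w ^+ 2) ->
  integrable (fun w => f w * g w).
Proof.
move=> mf mg f2 g2.
apply: (@le_integrable_EFin _ _ _ _ _ measurableT _ (fun w => f w ^+ 2 + g w ^+ 2)) => //.
- exact: measurable_funM.
- move=> w _; rewrite normrM -(real_normK (num_real (f w))) -(real_normK (num_real (g w))).
  by have := sqr_ge0 (`|f w| - `|g w|); have := normr_ge0 (f w); have := normr_ge0 (g w); nra.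
- exact: integrable_EFinD.
Qed.

Lemma integrable_mul_bounded f g (M : R) : measurable_fun setT g ->
  (forall w, `|g w| <= M) -> integrable f -> integrable (fun w => f w * g w).
Proof.
move=> mg gM fi; have mf : measurable_fun setT f by apply/measurable_EFinP; exact: measurable_int fi.
apply: (@le_integrable_EFin _ _ _ _ _ measurableT _ (fun w => M * `|f w|)) => //.
- exact: measurable_funM.
- by move=> w _; rewrite normrM mulrC ler_wpM2r.
- by apply: integrable_EFinZl => //; exact: integrable_norm.
Qed.

Lemma Rintegral_indic (A : set T) : measurable A -> \int[P]_w \1_A w = fine (P A).
Proof. by move=> mA; rewrite /Rintegral integral_indic// setIT. Qed.

Lemma integrable_mul_indic f (A : set T) : measurable A ->
  integrable f -> integrable (fun w => f w * \1_A w).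
Proof.
move=> mA fi; apply: (@integrable_mul_bounded _ _ 1) => // w.
by rewrite indicE; case: (_ \in _); rewrite ?normr1 ?normr0.
Qed.

End square_integrable.

(** * Series of independent centered random variables *)

Section centered_series.
Context d (T : measurableType d) (R : realType) (P : probability T R).
Variable X : nat -> {RV P >-> R}.
Hypothesis X_indep : independent_RVs X.
Hypothesis X_mean0 : forall i, \int[P]_w X i w = 0.
Hypothesis X_sqr : forall i, P.-integrable setT (EFin \o (fun w => X i w ^+ 2)).
Local Notation integrable f := (P.-integrable setT (EFin \o f)).

Let G i := g_sigma_algebraType
  (\bigcup_(k in [set k | k <> i]) preimage_set_system [set: T] (X k) (@measurable _ R)).

Lemma X_integrable i : integrable (X i).
Proof. by apply: integrable_sqr_integrable => //. Qed.

(** The common orthogonality relation: [Y] is a block sum in the variance formula, a block sum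
    restricted to an event in the maximal inequality, [f] at the other variables in Stein's step,
    and an indicator for the conditional expectation. *)
Lemma Rintegral_mul_centered i (Y : T -> R) : sigma_except_fun X i Y ->
  integrable Y -> \int[P]_w (X i w * Y w) = 0.
Proof.
move=> GY Yi; have [_] := Rintegral_mul_sigma_except X_indep (@measurable_id _ _ setT) (X_integrable i) GY Yi.
by move=> ->; rewrite X_mean0 mul0r.
Qed.

Lemma measurable_sum_except i (s : seq nat) : i \notin s ->
  measurable_fun (setT : set (G i)) (fun w => \sum_(k <- s) X k w).
Proof.
elim: s => [|k s IH].
  move=> _; rewrite [X in measurable_fun _ X](_ : _ = cst 0); first exact: measurable_cst.
  by apply/funext => w; rewrite big_nil.
rewrite inE negb_or eq_sym => /andP[ki /IH{}IH].
rewrite [Y in measurable_fun _ Y](_ : _ = X k \+ (fun w => \sum_(j <- s) X j w)); last first.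
  by apply/funext => w; rewrite big_cons.
by apply: measurable_funD => //; exact: measurable_fun_sigma_except.
Qed.

Let D m n w := \sum_(m <= k < n) X k w.

(** The sigma-algebra of all variables but [X j] contains the past of [j], so it can replace the
    usual filtration. *)
Let mD m n j : (n <= j)%N -> measurable_fun (setT : set (G j)) (D m n).
Proof.
by move=> nj; apply: measurable_sum_except; rewrite mem_index_iota ltnNge nj andbF.
Qed.

Let GD m n : sigma_except_fun X n (D m n).
Proof. by apply: sigma_except_fun_meas; exact: mD. Qed.

Lemma measurable_partial_sum m n : measurable_fun setT (fun w => \sum_(m <= k < n) X k w).
Proof. exact: sigma_except_funP (@GD m n). Qed.

Lemma partial_sum_sqr m n :
  integrable (fun w => (\sum_(m <= k < n) X k w) ^+ 2) /\
  \int[P]_w (\sum_(m <= k < n) X k w) ^+ 2 = \sum_(m <= k < n) \int[P]_w X k w ^+ 2.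
Proof.
elim: n => [|n [IHi IH]].
  rewrite [in RHS]big_geq//; under eq_Rintegral do rewrite big_geq// expr0n/=.
  rewrite Rintegral_cst// mul0r; split => //.
  rewrite (_ : (fun w => _) = fun=> 0); first exact: integrable_cst_prob.
  by apply/funext => w; rewrite big_geq// expr0n.
case: (leqP m n) => mn; last first.
  rewrite [in RHS]big_geq//; under eq_Rintegral do rewrite big_geq// expr0n/=.
  rewrite Rintegral_cst// mul0r; split => //.
  rewrite (_ : (fun w => _) = fun=> 0); first exact: integrable_cst_prob.
  by apply/funext => w; rewrite big_geq// expr0n.
have DE w : (\sum_(m <= k < n.+1) X k w) ^+ 2 = D m n w ^+ 2 + 2 * (X n w * D m n w) + X n w ^+ 2.
  by rewrite big_nat_recr//= -/(D m n w); ring.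
have Di : integrable (D m n) by apply: integrable_sqr_integrable => //; exact: measurable_partial_sum.
have XDi : integrable (fun w => X n w * D m n w).
  by apply: integrable_mul_sqr => //; exact: measurable_partial_sum.
have XD0 := Rintegral_mul_centered (@GD m n) Di.
under eq_Rintegral do rewrite DE.
have -> : (fun w => (\sum_(m <= k < n.+1) X k w) ^+ 2) =
  (fun w => D m n w ^+ 2 + 2 * (X n w * D m n w) + X n w ^+ 2) by exact/funext.
have i2 : integrable (fun w => 2 * (X n w * D m n w)) by exact: integrable_EFinZl.
have i1 : integrable (fun w => D m n w ^+ 2 + 2 * (X n w * D m n w)).
  exact: integrable_EFinD.
split; first exact: integrable_EFinD.
by rewrite !RintegralD// RintegralZl// XD0 mulr0 addr0 IH big_nat_recr.
Qed.

Let B m n (e : R) : set T :=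
  \bigcup_(k in [set k | (m <= k <= n)%N]) [set w | e <= `|D m k w|].

Let mB m n e : measurable (B m n e : set (G n)).
Proof.
apply: bigcup_measurable => k /= /andP[_ kn].
have mn : measurable_fun (setT : set (G n)) (fun w => `|D m k w|).
  by apply: measurableT_comp => //; exact: mD.
have := mn measurableT `[e, +oo[%classic (measurable_itv _).
rewrite setTI; congr (measurable _); apply/seteqP; split => w /=; rewrite in_itv/= andbT//.
Qed.

Let mB' m n e : measurable (B m n e).
Proof. by apply: (@sigma_except_measurable _ _ _ _ X n); exact: mB. Qed.

Let BS m n e : (m <= n.+1)%N -> B m n.+1 e = B m n e `|` [set w | e <= `|D m n.+1 w|].
Proof.
move=> mn; apply/seteqP; split => [w [k /= /andP[mk]]|w [[k /= /andP[mk kn] wk]|wn]].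
- rewrite leq_eqVlt => /predU1P[->|kn]; first by right.
  by move=> wk; left; exists k; rewrite //= mk.
- by exists k; rewrite //= mk ltnW.
- by exists n.+1; rewrite //= mn leqnn.
Qed.

(** In place of a decomposition by the first passage time, the sharper inequality with the square
    integrated over the event alone is proved by induction on [n]. *)
Lemma kolmogorov_maximal m n (e : R) : 0 < e ->
  e ^+ 2 * fine (P (\bigcup_(k in [set k | (m <= k <= n)%N])
    [set w | e <= `|\sum_(m <= j < k) X j w|])) <=
  \sum_(m <= k < n) \int[P]_w X k w ^+ 2.
Proof.
move=> e0; rewrite -/(B m n e).
suff : e ^+ 2 * fine (P (B m n e)) <= \int[P]_w (D m n w ^+ 2 * \1_(B m n e) w).
  move=> /le_trans; apply; have [Di <-] := partial_sum_sqr m n.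
  apply: le_Rintegral => //; first exact: integrable_mul_indic.
  move=> w _; rewrite indicE; case: (_ \in _); first by rewrite mulr1.
  by rewrite mulr0 sqr_ge0.
have B0 k : (k <= m)%N -> B m k e = set0.
  move=> km; apply/seteqP; split => // w [j /= /andP[mj jk]].
  by rewrite /D big_geq ?(leq_trans jk)// normr0 leNgt e0.
elim: n => [|n IH].
  by rewrite B0// measure0/= mulr0; apply: Rintegral_ge0 => w _; rewrite mulr_ge0// sqr_ge0.
case: (leqP n.+1 m) => mn.
  by rewrite B0// measure0/= mulr0; apply: Rintegral_ge0 => w _; rewrite mulr_ge0// sqr_ge0.
have [Di _] := partial_sum_sqr m n; have [Di' _] := partial_sum_sqr m n.+1.
pose Y w := D m n w * \1_(B m n e) w.
have GY : sigma_except_fun X n Y.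
  apply: sigma_except_fun_meas; apply: measurable_funM; first exact: mD.
  exact: measurable_indic.
have Yi : integrable Y.
  apply: integrable_mul_indic => //.
  by apply: integrable_sqr_integrable => //; exact: measurable_partial_sum.
have mY := sigma_except_funP GY.
have XYi : integrable (fun w => X n w * Y w).
  by have [] := Rintegral_mul_sigma_except X_indep (@measurable_id _ _ setT) (X_integrable n) GY Yi.
have XY0 := Rintegral_mul_centered GY Yi.
have i1 : integrable (fun w => D m n w ^+ 2 * \1_(B m n e) w) by exact: integrable_mul_indic.
have iB k : integrable (\1_(B m k e) : T -> R) by exact: integrable_indic.
have iB' k : integrable (fun w => e ^+ 2 * \1_(B m k e) w) by exact: integrable_EFinZl.
have i2 : integrable (fun w => 2 * (X n w * Y w)) by exact: integrable_EFinZl.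
have i3 : integrable (fun w => D m n w ^+ 2 * \1_(B m n e) w + 2 * (X n w * Y w)).
  exact: integrable_EFinD.
have i4 : integrable (fun w => e ^+ 2 * \1_(B m n.+1 e) w - e ^+ 2 * \1_(B m n e) w).
  exact: integrable_EFinB.
(* A pointwise minorant of [D m n.+1 w ^+ 2] on the event at time [n.+1]: where the event already
   held, [X n w ^+ 2] is dropped from the square; where it is new, the square is at least [e ^+ 2].
   The cross term integrates to 0. *)
apply: (@le_trans _ _ (\int[P]_w (D m n w ^+ 2 * \1_(B m n e) w + 2 * (X n w * Y w) +
    (e ^+ 2 * \1_(B m n.+1 e) w - e ^+ 2 * \1_(B m n e) w)))).
  rewrite RintegralD// RintegralD// RintegralZl// XY0 mulr0 addr0 RintegralB//.
  rewrite !RintegralZl// !Rintegral_indic//.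
  by rewrite addrCA lerDl subr_ge0.
apply: le_Rintegral => //; first exact: integrable_EFinD.
  exact: integrable_mul_indic.
move=> w _; rewrite /Y.
have DS : D m n.+1 w = D m n w + X n w by rewrite /D big_nat_recr.
have mn' : (m <= n.+1)%N by exact: ltnW.
case: (pselect (B m n e w)) => Bn.
  have Bn1 : B m n.+1 e w by rewrite BS//; left.
  rewrite !indicE !mem_set// !mulr1 subrr addr0 DS.
  by have := sqr_ge0 (X n w); nra.
rewrite !indicE (memNset Bn) !mulr0 !add0r subr0.
case: (pselect (B m n.+1 e w)) => Bn1; last by rewrite memNset// !mulr0.
rewrite mem_set// !mulr1; move: Bn1; rewrite BS// => -[//|/= H].
by rewrite -(real_normK (num_real (D m n.+1 w))); nra.
Qed.

End centered_series.

(** * Measurability of pointwise limits *)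

Section real_sequences.
Context {R : realType}.

(** The Cauchy criterion with all quantifiers over natural numbers, so that the set of convergence
    becomes a countable combination of events. *)
Lemma cvgn_harmonicP (a : nat -> R) : cvgn a <->
  forall j, exists m, forall k, (m <= k)%N -> `|a k - a m| <= j.+1%:R^-1.
Proof.
split => [/cvg_cauchy/cauchy_ballP ca j|H].
  have [[A B] [[m _ mA] [m' _ mB]] AB] := ca j.+1%:R^-1 (ltac:(by rewrite invr_gt0)).
  exists (maxn m m') => k; rewrite geq_max => /andP[mk mk'].
  apply: ltW; have := AB (a k, a (maxn m m')) => /=; rewrite /ball/=; apply; split => /=.
    exact: mA.
  by apply: mB; rewrite /= leq_maxr.
apply/cauchy_cvgP/cauchy_exP => e e0.
have [j je] : exists j : nat, j.+1%:R^-1 < e :> R.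
  have := @cvg_harmonic R; move/cvgrPdist_lt => /(_ e e0) [j _ /(_ j)] /= H'.
  by exists j; have := H' (leqnn j); rewrite sub0r normrN ger0_norm ?invr_ge0.
have [m mk] := H j; exists (a m), m => // k /= /mk.
by rewrite /ball/= distrC => /le_lt_trans; apply.
Qed.

Lemma measurable_limn d (T : measurableType d) (u : nat -> T -> R) :
  (forall n, measurable_fun setT (u n)) ->
  measurable_fun setT (fun w => limn (u ^~ w)).
Proof.
move=> mu; pose C := [set w | cvgn (u ^~ w)].
have mC : measurable C.
  have -> : C = \bigcap_j \bigcup_m \bigcap_(k in [set k | (m <= k)%N])
      [set w | `|u k w - u m w| <= j.+1%:R^-1].
    apply/seteqP; split => [w /cvgn_harmonicP Cw j _|w Cw].
      by have [m mP] := Cw j; exists m => // k /= /mP.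
    by apply/cvgn_harmonicP => j; have [m _ mP] := Cw j I; exists m => k /mP.
  apply: bigcap_measurableType => j _; apply: bigcup_measurable => m _.
  apply: bigcap_measurableType => k _.
  have mk : measurable_fun setT (fun w => `|u k w - u m w| <= j.+1%:R^-1).
    apply: measurable_fun_ler => //; apply: measurableT_comp => //.
    exact: measurable_funB.
  by have := mk measurableT [set true] (ltac:(by [])); rewrite setTI.
have mC1 : measurable_fun setT (\1_C : T -> R) by exact: measurable_indic.
apply: (@measurable_fun_cvg _ _ _ _ (fun n w => u n w * \1_C w)).
  by move=> n; exact: measurable_funM.
move=> w _; rewrite indicE; case: (pselect (C w)) => Cw.
  rewrite mem_set//; under eq_fun do rewrite mulr1; exact: Cw.
rewrite memNset//; under eq_fun do rewrite mulr0.
(* Where the sequence diverges, [limn] is the default element of [R], namely 0, which is also the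
   limit of the sequence cut off by [\1_C]. *)
by rewrite (dvgP Cw); exact: cvg_cst.
Qed.

End real_sequences.

Section ae_integral.
Context d (T : measurableType d) (R : realType) (P : {measure set T -> \bar R}).

Lemma ae_eq_Rintegral (f g : T -> R) :
  measurable_fun setT f -> measurable_fun setT g ->
  {ae P, forall w, f w = g w} -> \int[P]_w f w = \int[P]_w g w.
Proof.
move=> mf mg fg; congr fine; apply: ae_eq_integral => //.
- exact/measurable_EFinP.
- exact/measurable_EFinP.
- by apply: filterS fg => w -> .
Qed.

Lemma ae_fatou (u : nat -> T -> \bar R) (f : T -> \bar R) (M : \bar R) :
    (forall n, measurable_fun setT (u n)) -> measurable_fun setT f ->
    (forall n w, 0 <= u n w)%E -> (forall w, 0 <= f w)%E ->
    {ae P, forall w, u n w @[n --> \oo] --> f w} ->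
    (forall n, \int[P]_w u n w <= M)%E ->
  (\int[P]_w f w <= M)%E.
Proof.
move=> mu mf u0 f0 [A [mA PA0 uA]] uM.
rewrite (ge0_negligible_integral mA)//.
have mD : measurable ([set: T] `\` A) by exact: measurableD.
rewrite (eq_integral (fun w => limn_einf (u ^~ w))); last first.
  move=> w /[!inE] -[_ Aw].
  have cw : u n w @[n --> \oo] --> f w by apply: contrapT => H; exact/Aw/uA.
  by rewrite (cvg_limn_einf_sup cw).1.
apply: (le_trans (fatou P mD _ _)).
- by move=> n; exact: measurable_funTS.
- by move=> n w _.
rewrite limn_einf_lim; apply: lime_le; first exact: is_cvg_einfs.
near=> n; apply: (@le_trans _ _ (\int[P]_(w in [set: T] `\` A) u n w)%E).
  by apply: ereal_inf_lbound; exists n => /=.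
by apply: le_trans (uM n); apply: ge0_subset_integral.
Unshelve. all: by end_near. Qed.

End ae_integral.

(** * Almost sure and first-mean convergence of the series *)

Section centered_series_cvg.
Context d (T : measurableType d) (R : realType) (P : probability T R).
Variable X : nat -> {RV P >-> R}.
Hypothesis X_indep : independent_RVs X.
Hypothesis X_mean0 : forall i, \int[P]_w X i w = 0.
Hypothesis X_sqr : forall i, P.-integrable setT (EFin \o (fun w => X i w ^+ 2)).
Variable V : R.
Hypothesis cvg_var : \sum_(0 <= i < n) \int[P]_w X i w ^+ 2 @[n --> \oo] --> V.
Local Notation integrable f := (P.-integrable setT (EFin \o f)).
Local Notation S n w := (\sum_(0 <= i < n) X i w).

Let v i := \int[P]_w X i w ^+ 2.

Let v_ge0 i : 0 <= v i.
Proof. by apply: Rintegral_ge0 => w _; rewrite sqr_ge0. Qed.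

Lemma partial_var_le m n :
  \sum_(m <= i < n) \int[P]_w X i w ^+ 2 <= V - \sum_(0 <= i < m) \int[P]_w X i w ^+ 2.
Proof.
have nd : {homo (fun n => \sum_(0 <= i < n) v i) : a b / (a <= b)%N >-> a <= b}.
  by move=> a b ab; rewrite (big_cat_nat (leq0n _) ab)//= lerDl sumr_ge0.
have le_V k : \sum_(0 <= i < k) v i <= V.
  by have := nondecreasing_cvgn_le nd (cvgP _ cvg_var) k; rewrite (cvg_lim _ cvg_var).
case: (leqP m n) => mn.
  by rewrite lerBrDl -big_cat_nat//; exact: le_V.
by rewrite big_geq ?(ltnW mn)// subr_ge0; exact: le_V.
Qed.

Let tail_cvg0 : (V - \sum_(0 <= i < n) v i) @[n --> \oo] --> (0 : R).
Proof. by rewrite -[X in _ --> X](subrr V); apply: cvgB => //; exact: cvg_cst. Qed.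

(** The outer union over [n] is increasing, so the bounds of the maximal inequality pass to the
    limit and control the probability that some block sum started at [m] ever reaches [e]. *)
Let E m e : set T := \bigcup_n (\bigcup_(k in [set k | (m <= k <= n)%N])
    [set w | e <= `|\sum_(m <= j < k) X j w|]).

Let mB m n e : measurable (\bigcup_(k in [set k | (m <= k <= n)%N])
    [set w | e <= `|\sum_(m <= j < k) X j w|]).
Proof.
apply: bigcup_measurable => k _.
have mk : measurable_fun setT (fun w => e <= `|\sum_(m <= j < k) X j w|).
  apply: measurable_fun_ler => //; apply: measurableT_comp => //.
  exact: measurable_partial_sum.
by have := mk measurableT [set true] (ltac:(by [])); rewrite setTI.
Qed.

Let mE m e : measurable (E m e).
Proof. exact: bigcup_measurable. Qed.

Let P_E m e : 0 < e ->
  fine (P (E m e)) <= (V - \sum_(0 <= i < m) v i) / e ^+ 2.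
Proof.
move=> e0; have e20 : 0 < e ^+ 2 by rewrite exprn_gt0.
rewrite -lee_fin fineK ?fin_num_measure//.
have c : P (\bigcup_(k in [set k | (m <= k <= n)%N])
    [set w | e <= `|\sum_(m <= j < k) X j w|]) @[n --> \oo] --> P (E m e).
  apply: nondecreasing_cvg_mu => //; first exact: mE.
  move=> a b ab; apply/subsetPset => w [k /= /andP[mk ka] wk].
  by exists k => //=; rewrite mk (leq_trans ka).
rewrite -(cvg_lim _ c)//; apply: lime_le; first exact: (cvgP _ c).
near=> n; rewrite -[leLHS]fineK ?fin_num_measure// lee_fin ler_pdivlMr// mulrC.
apply: le_trans (kolmogorov_maximal X_indep X_mean0 X_sqr m n e0) _.
exact: partial_var_le.
Unshelve. all: by end_near. Qed.

Let P_EI e : 0 < e -> P (\bigcap_m E m e) = 0.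
Proof.
move=> e0; have mI : measurable (\bigcap_m E m e).
  by apply: bigcap_measurableType => m _; exact: mE.
have e20 : 0 < e ^+ 2 by rewrite exprn_gt0.
have p0 : 0 <= fine (P (\bigcap_m E m e)) by rewrite fine_ge0.
rewrite -[LHS]fineK ?fin_num_measure//; congr EFin.
apply/eqP; rewrite eq_le p0 andbT leNgt; apply/negP => p1.
have /cvgrPdist_lt/(_ (fine (P (\bigcap_m E m e)) * e ^+ 2)) := tail_cvg0.
rewrite mulr_gt0// => /(_ isT) [m _ /(_ m (leqnn m))]; apply/negP; rewrite -leNgt.
rewrite -ler_pdivlMr// sub0r normrN ger0_norm; last first.
  by have := partial_var_le m m; rewrite big_geq.
apply: le_trans (P_E m e0).
apply: fine_le; [exact: fin_num_measure|exact/fin_num_measure/mE|].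
have mEm := mE m e.
by apply: le_measure; rewrite ?inE// => w /(_ m I).
Qed.

(** Outside the exceptional set each threshold [j.+1%:R^-1] has some [m] from which no block sum
    reaches it, which is the Cauchy criterion. The exceptional set is null since the tail of the
    variance series tends to 0. *)
Lemma ae_cvg_partial_sum : {ae P, forall w, cvgn (fun n => S n w)}.
Proof.
have : P.-negligible (\bigcup_j \bigcap_m E m j.+1%:R^-1).
  apply: negligible_bigcup => j; exists (\bigcap_m E m j.+1%:R^-1); split => //.
  - by apply: bigcap_measurableType => m _; exact: mE.
  - by apply: P_EI; rewrite invr_gt0.
apply: negligibleS => w /= ncw; apply: contrapT => nE; apply: ncw.
apply/cvgn_harmonicP => j.
have /existsNP[m mE'] : ~ (forall m, E m j.+1%:R^-1 w).
  by move=> H; apply: nE; exists j => // m _.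
exists m => k mk; rewrite leNgt; apply/negP => jk; apply: mE'.
exists k => //; exists k => /=; first by rewrite mk leqnn.
by move: jk; rewrite (big_cat_nat (leq0n _) mk)//= addrAC subrr add0r => /ltW.
Qed.

Lemma measurable_limn_partial_sum : measurable_fun setT (fun w => limn (fun n => S n w)).
Proof. by apply: measurable_limn => n; exact: measurable_partial_sum. Qed.

(** The inequality [|a| <= a ^+ 2 / e + e] turns the variance of a block into a first-moment bound
    without square roots, and Fatou's lemma lets the end of the block go to infinity. *)
Lemma integral_limn_sub_partial_sum n (e : R) : 0 < e ->
  (\int[P]_w `|(limn (fun n => S n w) - S n w)%:E| <=
   ((V - \sum_(0 <= i < n) \int[P]_w X i w ^+ 2) / e + e)%:E)%E.
Proof.
move=> e0; apply: (@ae_fatou _ _ _ _ (fun m w => `|(S (n + m)%N w - S n w)%:E|%E)) => //.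
- move=> m; apply: measurableT_comp => //; apply/measurable_EFinP.
  by apply: measurable_funB; exact: measurable_partial_sum.
- apply: measurableT_comp => //; apply/measurable_EFinP.
  by apply: measurable_funB; [exact: measurable_limn_partial_sum|exact: measurable_partial_sum].
- apply: filterS ae_cvg_partial_sum => w cw.
  apply: cvg_abse; apply: cvg_EFin; first exact: nearW.
  apply: cvgB; last exact: cvg_cst.
  by have := cw; rewrite -(cvg_shiftn n); under eq_fun do rewrite addnC.
- move=> m; have nm : (n <= n + m)%N by exact: leq_addr.
  have [D2 DE] := partial_sum_sqr X_indep X_mean0 X_sqr n (n + m).
  have mD : measurable_fun setT (fun w => \sum_(n <= k < n + m) X k w).
    exact: measurable_partial_sum.
  have Di := integrable_sqr_integrable mD D2.
  have i1 : integrable (fun w => e^-1 * (\sum_(n <= k < n + m) X k w) ^+ 2 + e).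
    apply: integrable_EFinD => //; last exact: integrable_cst_prob.
    exact: integrable_EFinZl.
  rewrite (_ : (\int[P]_w _)%E = (\int[P]_w `|\sum_(n <= k < n + m) X k w|)%:E); last first.
    rewrite /Rintegral fineK; last first.
      by apply: integrable_fin_num => //; exact: integrable_norm.
    apply: eq_integral => w _; rewrite (big_cat_nat (leq0n _) nm)//= addrAC subrr add0r//.
  rewrite lee_fin; apply: (@le_trans _ _ (\int[P]_w (e^-1 * (\sum_(n <= k < n + m) X k w) ^+ 2 + e))).
    apply: le_Rintegral => //; first exact: integrable_norm.
    move=> w _; set a := \sum_(_ <= _ < _) _.
    rewrite -(ler_pM2l e0) mulrDr mulrA divff ?gt_eqF// mul1r.
    rewrite -(real_normK (num_real a)).
    by have := normr_ge0 a; have := sqr_ge0 (`|a| - e); nra.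
  rewrite RintegralD//; last 2 first.
  - exact: integrable_EFinZl.
  - exact: integrable_cst_prob.
  rewrite RintegralZl// DE Rintegral_cst_prob lerD2r mulrC.
  by rewrite ler_pM2r ?invr_gt0//; exact: partial_var_le.
Qed.

Lemma integrable_limn_partial_sum : integrable (fun w => limn (fun n => S n w)).
Proof.
apply/integrableP; split.
  by apply/measurable_EFinP; exact: measurable_limn_partial_sum.
have := integral_limn_sub_partial_sum 0 (@ltr01 R).
under eq_integral do rewrite big_geq// subr0.
by move=> /le_lt_trans; apply; rewrite ltry.
Qed.

End centered_series_cvg.

(** * Integration against the normal law through its density *)

Section normal01_integral.
Context {R : realType}.
Local Notation mu := (@lebesgue_measure R).
Local Notation phi := (@normal_pdf R 0 1).
Local Notation nu := (@normal_prob R 0 1).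
Local Notation density := (Radon_Nikodym_SigmaFinite.f nu mu).

Let measurable_EFin_phi : measurable_fun setT (EFin \o phi).
Proof. by apply/measurable_EFinP; exact: measurable_normal_pdf. Qed.

Let measurable_density : measurable_fun setT density.
Proof.
apply: (measurable_int mu); apply: Radon_Nikodym_SigmaFinite.f_integrable.
exact: normal_prob_dominates.
Qed.

(** Both functions integrate to [nu E] over every measurable set [E]: one by the Radon-Nikodym
    theorem, the other by the definition of the normal law. *)
Let density_ae : ae_eq mu setT density (EFin \o phi).
Proof.
apply: integral_ae_eq => //.
  by apply: Radon_Nikodym_SigmaFinite.f_integrable; exact: normal_prob_dominates.
move=> E _ mE; rewrite -Radon_Nikodym_SigmaFinite.f_integral//.
exact: normal_prob_dominates.
Qed.

Lemma ge0_integral_normal01 (f : R -> \bar R) : measurable_fun setT f ->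
  (forall x, 0 <= f x)%E ->
  (\int[nu]_x f x = \int[mu]_x (f x * (phi x)%:E))%E.
Proof.
move=> mf f0; rewrite -(@Radon_Nikodym_SigmaFinite.change_of_variables _ _ _ _ mu)//; last first.
  exact: normal_prob_dominates.
apply: ae_eq_integral => //.
- exact: emeasurable_funM.
- exact: emeasurable_funM.
- by apply: ae_eqe_mul2l; exact: density_ae.
Qed.

Lemma integral_normal01 (h : R -> R) : measurable_fun setT h ->
  mu.-integrable setT (EFin \o (fun x => h x * phi x)) ->
  \int[nu]_x h x = \int[mu]_x (h x * phi x) /\ nu.-integrable setT (EFin \o h).
Proof.
move=> mh hi; have mEh : measurable_fun setT (EFin \o h) by exact/measurable_EFinP.
split.
  rewrite /Rintegral; congr fine; rewrite integralE [RHS]integralE.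
  rewrite !ge0_integral_normal01//; last 2 first.
  - exact: measurable_funeneg.
  - exact: measurable_funepos.
  congr (_ - _)%E; apply: eq_integral => x _.
    by rewrite !funeposE -!EFin_max -EFinM maxr_pMl ?mul0r ?normal_pdf_ge0.
  by rewrite !funenegE -!EFinN -!EFin_max -EFinM maxr_pMl ?mul0r ?mulNr ?normal_pdf_ge0.
apply/integrableP; split => //; rewrite ge0_integral_normal01//; last exact: measurableT_comp.
have /integrableP[_] := hi; congr (_ < _)%E; apply: eq_integral => x _.
by rewrite /= normrM (ger0_norm (normal_pdf_ge0 _ _ _)) EFinM.
Qed.

End normal01_integral.

Lemma integral_law d d' (T : measurableType d) (T' : measurableType d')
    (R : realType) (P : {measure set T -> \bar R}) (nu : {measure set T' -> \bar R})
    (Y : T -> T') (g : T' -> \bar R) :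
    measurable_fun setT Y ->
    (forall A : set T', measurable A -> P (Y @^-1` A) = nu A) ->
    nu.-integrable setT g ->
  (\int[P]_w g (Y w) = \int[nu]_x g x)%E.
Proof.
move=> mY YE gi; have mg := measurable_int nu gi.
pose Y' : {mfun T >-> T'} := mfun_Sub (mem_set mY : Y \in mfun).
have Y'E (A : set T') : measurable A -> A `<=` setT -> nu A = pushforward P Y' A.
  by move=> mA _; apply/esym; exact: YE.
rewrite (eq_measure_integral _ Y'E) [RHS]integral_pushforward//.
apply/integrableP; split; first exact: measurableT_comp.
have /integrableP[_] := gi.
by rewrite (eq_measure_integral _ Y'E) ge0_integral_pushforward//; exact: measurableT_comp.
Qed.

Lemma expectation_normal01 d (T : measurableType d) (R : realType)
    (P : probability T R) (N : {RV P >-> R}) (h : R -> R) :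
    (forall A : set R, measurable A -> distribution P N A = normal_prob 0 1 A) ->
    measurable_fun setT h ->
    lebesgue_measure.-integrable setT (EFin \o (fun x => h x * normal_pdf 0 1 x)) ->
  'E_P[h \o N]%E = (\int[lebesgue_measure]_x (h x * normal_pdf 0 1 x))%:E.
Proof.
move=> NE mh hi; have [hE hn] := integral_normal01 mh hi.
have mEh : measurable_fun setT (EFin \o h) by exact/measurable_EFinP.
have mEhN : measurable_fun setT (EFin \o (h \o N)).
  by apply/measurable_EFinP; exact: measurableT_comp.
have mN : measurable_fun setT (N : T -> measurableTypeR R).
  by move=> _ B mB; exact: (measurable_funPT N measurableT B mB).
rewrite unlock -hE /Rintegral fineK ?integrable_fin_num//.
exact: (integral_law mN NE hn).
Qed.

(** * The normal approximation *)

Section moments.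
Context d (T : measurableType d) (R : realType) (P : probability T R).
Local Notation integrable f := (P.-integrable setT (EFin \o f)).

(* Integrate [0 <= (|f| + m) (|f| - m) ^ 2] with [m] the mean of [|f|]. *)
Lemma Rintegral_sqr_mul_norm_le (f : T -> R) : measurable_fun setT f ->
    integrable (fun w => f w ^+ 2) -> integrable (fun w => `|f w| ^+ 3) ->
  (\int[P]_w f w ^+ 2) * (\int[P]_w `|f w|) <= \int[P]_w `|f w| ^+ 3.
Proof.
move=> mf f2 f3; have f1 : integrable (fun w => `|f w|).
  by apply: integrable_norm; exact: integrable_sqr_integrable.
set m := \int[P]_w `|f w|.
have m0 : 0 <= m by apply: Rintegral_ge0.
have mf2 : integrable (fun w => m * f w ^+ 2) by exact: integrable_EFinZl.
have mf1 : integrable (fun w => m ^+ 2 * `|f w|) by exact: integrable_EFinZl.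
have i1 : integrable (fun w => `|f w| ^+ 3 - m * f w ^+ 2) by exact: integrable_EFinB.
have i2 : integrable (fun w => `|f w| ^+ 3 - m * f w ^+ 2 - m ^+ 2 * `|f w|).
  exact: integrable_EFinB.
have : 0 <= \int[P]_w (`|f w| ^+ 3 - m * f w ^+ 2 - m ^+ 2 * `|f w| + m ^+ 3).
  apply: Rintegral_ge0 => w _; rewrite -(real_normK (num_real (f w))).
  rewrite (_ : _ + _ = (`|f w| + m) * (`|f w| - m) ^+ 2); last by ring.
  by rewrite mulr_ge0 ?addr_ge0 ?sqr_ge0.
rewrite RintegralD//; last exact: integrable_cst_prob.
rewrite RintegralB// RintegralB// Rintegral_cst_prob !RintegralZl// -/m.
nra.
Qed.

End moments.

Section stein_step.
Context d (T : measurableType d) (R : realType) (P : probability T R).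
Variable X : nat -> {RV P >-> R}.
Hypothesis X_indep : independent_RVs X.
Hypothesis X_mean0 : forall i, \int[P]_w X i w = 0.
Hypothesis X_sqr : forall i, P.-integrable setT (EFin \o (fun w => X i w ^+ 2)).
Hypothesis X_cube : forall i, P.-integrable setT (EFin \o (fun w => `|X i w| ^+ 3)).
Variables f f' : R -> R.
Hypothesis f_deriv : forall x : R, is_derive x 1 f (f' x).
Hypothesis f_bounded : forall x, `|f x| <= 1.
Hypothesis f'_bounded : forall x, `|f' x| <= 4.
Hypothesis f'_lip : forall x y, `|f' x - f' y| <= 2 * `|x - y|.
Local Notation integrable f := (P.-integrable setT (EFin \o f)).

Let measurable_f : measurable_fun setT f.
Proof.
exact: continuous_measurable_fun (is_derive_continuous f_deriv).
Qed.

Let measurable_f' : measurable_fun setT f'.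
Proof.
exact: continuous_measurable_fun (klipschitz_continuous (ltr0Sn _ 1) f'_lip).
Qed.

(** The mean value theorem gives the increment as [f' z * (y - x)] with [z] between [x] and [y], and
    [f' z] differs from [f' x] by at most [2 * |y - x|]. *)
Let taylor x y : `|f y - f x - f' x * (y - x)| <= 2 * (y - x) ^+ 2.
Proof.
(* [c] is the base point of the expansion: the left end when [x <= y], the right end otherwise. *)
have step a b c z : a <= z <= b -> a <= c <= b -> f b - f a = f' z * (b - a) ->
    `|f b - f a - f' c * (b - a)| <= 2 * (b - a) ^+ 2.
  move=> /andP[az zb] /andP[ac cb] ->; rewrite -mulrBl normrM.
  have ab : 0 <= b - a by rewrite subr_ge0 (le_trans ac).
  rewrite (ger0_norm ab) expr2 mulrA ler_wpM2r//.
  by apply: le_trans (f'_lip _ _) _; rewrite ler_pM2l// ler_norml; lra.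
case: (leP x y) => [xy|/ltW yx].
  have [z /[dup] xzy /andP[xz zy] E] := MVT_everywhere xy f_deriv.
  by apply: (step x y x z) => //; rewrite lexx xy.
have [z /[dup] xzy /andP[xz zy] E] := MVT_everywhere yx f_deriv.
have := step y x x z xzy _ E; rewrite lexx yx => /(_ isT).
rewrite (_ : 2 * (x - y) ^+ 2 = 2 * (y - x) ^+ 2); last by ring.
by rewrite -normrN; congr (`|_| <= _); ring.
Qed.

(** [A] stands for the sum without [X i]. Expanding [f] at [c * A], the constant term contributes
    mean 0 and the linear term factors as [c * E X_i^2 * E f'(c * A)], with error
    [2 * c ^+ 2 * E |X_i|^3]. Replacing [f' (c * A)] by [f'] at the full sum costs as much again,
    since [E X_i^2 * E |X_i| <= E |X_i|^3]. *)
Lemma stein_step (c : R) i (A : T -> R) : 0 <= c -> sigma_except_fun X i A ->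
  `|\int[P]_w (X i w * f (c * (A w + X i w)))
    - c * \int[P]_w X i w ^+ 2 * \int[P]_w f' (c * (A w + X i w))|
  <= 4 * c ^+ 2 * \int[P]_w `|X i w| ^+ 3.
Proof.
move=> c0 GA; have mA := sigma_except_funP GA.
have Xi := X_integrable X_sqr i.
have mcA : measurable_fun setT (fun w => c * A w) by exact: measurable_funM.
have mcAX : measurable_fun setT (fun w => c * (A w + X i w)).
  by apply: measurable_funM => //; exact: measurable_funD.
have mfA : measurable_fun setT (fun w => f (c * A w)) by exact: (measurableT_comp measurable_f).
have mf'A : measurable_fun setT (fun w => f' (c * A w)) by exact: (measurableT_comp measurable_f').
have mfAX : measurable_fun setT (fun w => f (c * (A w + X i w))).
  exact: (measurableT_comp measurable_f).
have mf'AX : measurable_fun setT (fun w => f' (c * (A w + X i w))).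
  exact: (measurableT_comp measurable_f').
have bounded_int (g : T -> R) M : measurable_fun setT g -> (forall w, `|g w| <= M) -> integrable g.
  move=> mg gM; apply: (@le_integrable_EFin _ _ _ _ _ measurableT _ (fun=> M)) => //.
  exact: integrable_cst_prob.
have fAi : integrable (fun w => f (c * A w)) by exact: bounded_int.
have f'Ai : integrable (fun w => f' (c * A w)) by exact: bounded_int.
have f'AXi : integrable (fun w => f' (c * (A w + X i w))) by exact: bounded_int.
have G_comp g : measurable_fun setT g -> sigma_except_fun X i (fun w => g (c * A w)).
  move=> mg B mB; have mgc : measurable_fun setT (fun x : R => g (c * x)).
    by apply: (measurableT_comp mg); exact: mulrl_measurable.
  rewrite (_ : _ @^-1` B = A @^-1` ((fun x => g (c * x)) @^-1` B))//.
  apply: GA; rewrite -[X in measurable X]setTI; exact: mgc.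
have E1 : \int[P]_w (X i w * f (c * A w)) = 0.
  by apply: (Rintegral_mul_centered X_indep) => //; exact: G_comp.
have [i2 E2] := @Rintegral_mul_sigma_except _ _ _ _ _ X_indep i (fun x => x ^+ 2) _
  (measurable_funX 2 (@measurable_id _ _ setT)) (X_sqr i) (G_comp _ measurable_f') f'Ai.
have i1 : integrable (fun w => X i w * f (c * A w)).
  exact: (integrable_mul_bounded mfA (fun w => f_bounded (c * A w)) Xi).
have i3 : integrable (fun w => X i w * f (c * (A w + X i w))).
  exact: (integrable_mul_bounded mfAX (fun w => f_bounded (c * (A w + X i w))) Xi).
have i4 : integrable (fun w => c * (X i w ^+ 2 * f' (c * A w))) by exact: integrable_EFinZl.
have i5 : integrable (fun w => X i w * f (c * (A w + X i w)) - X i w * f (c * A w)).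
  exact: integrable_EFinB.
have D1 : `|\int[P]_w (X i w * f (c * (A w + X i w)))
    - c * (\int[P]_w X i w ^+ 2 * \int[P]_w f' (c * A w))| <=
    2 * c ^+ 2 * \int[P]_w `|X i w| ^+ 3.
  have -> : \int[P]_w (X i w * f (c * (A w + X i w)))
      - c * (\int[P]_w X i w ^+ 2 * \int[P]_w f' (c * A w)) =
    \int[P]_w (X i w * f (c * (A w + X i w)) - X i w * f (c * A w)
      - c * (X i w ^+ 2 * f' (c * A w))).
    by rewrite RintegralB// RintegralB// E1 subr0 RintegralZl// E2.
  apply: le_trans (le_normr_Rintegral _ _) _ => //; first exact: integrable_EFinB.
  rewrite -RintegralZl//; apply: le_Rintegral => //.
  - by apply: integrable_norm; exact: integrable_EFinB.
  - exact: integrable_EFinZl.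
  - move=> w _; have := taylor (c * A w) (c * (A w + X i w)).
    rewrite (_ : c * (A w + X i w) - c * A w = c * X i w); last by ring.
    set F := _ - _ - _ => FB.
    rewrite (_ : _ - _ = X i w * F); last by rewrite /F; ring.
    rewrite normrM exprS.
    rewrite (_ : 2 * c ^+ 2 * _ = `|X i w| * (2 * (c ^+ 2 * `|X i w| ^+ 2))); last by ring.
    by rewrite ler_wpM2l// (real_normK (num_real _)) -exprMn.
have D2 : `|\int[P]_w f' (c * A w) - \int[P]_w f' (c * (A w + X i w))| <=
    2 * c * \int[P]_w `|X i w|.
  rewrite -RintegralB//; apply: le_trans (le_normr_Rintegral _ _) _ => //.
    exact: integrable_EFinB.
  rewrite -RintegralZl//; last exact: integrable_norm.
  apply: le_Rintegral => //.
  - by apply: integrable_norm; exact: integrable_EFinB.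
  - by apply: integrable_EFinZl => //; exact: integrable_norm.
  - move=> w _; apply: le_trans (f'_lip _ _) _.
    rewrite (_ : c * A w - c * (A w + X i w) = - (c * X i w)); last by ring.
    by rewrite normrN normrM (ger0_norm c0) mulrA.
have M3 := Rintegral_sqr_mul_norm_le (measurable_funPT (X i)) (X_sqr i) (X_cube i).
have v0 : 0 <= \int[P]_w X i w ^+ 2 by apply: Rintegral_ge0 => w _; rewrite sqr_ge0.
move: D1 D2 M3 v0; set v := \int[P]_w X i w ^+ 2; set m := \int[P]_w `|X i w|.
set b := \int[P]_w `|X i w| ^+ 3; set p := \int[P]_w f' (c * A w).
set q := \int[P]_w f' _; set a := \int[P]_w _ => D1 D2 M3 v0.
have -> : a - c * v * q = (a - c * (v * p)) + c * v * (p - q) by ring.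
apply: le_trans (ler_normD _ _) _.
have : `|c * v * (p - q)| <= 2 * c ^+ 2 * b.
  rewrite normrM (ger0_norm (_ : 0 <= c * v)) ?mulr_ge0//.
  apply: (@le_trans _ _ (c * v * (2 * c * m))); first by rewrite ler_wpM2l ?mulr_ge0.
  rewrite (_ : _ * _ = 2 * c ^+ 2 * (v * m)); last by ring.
  by rewrite ler_wpM2l// mulr_ge0// sqr_ge0.
lra.
Qed.

End stein_step.

(** * Almost sure uniqueness of conditional expectations *)

Section cond_exp_unique.
Context d (T : measurableType d) (R : realType) (P : probability T R).

(** [Y <= Z] is an event of the sigma-algebra; [Y - Z] has integral 0 over it and over its
    complement, so [|Y - Z|] has integral 0. *)
Lemma is_cond_exp_ae_unique (G0 : set (set T)) (F Y Z : T -> R) :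
    <<s G0 >> `<=` (@measurable _ T) ->
    is_cond_exp P <<s G0 >> F Y -> is_cond_exp P <<s G0 >> F Z ->
  {ae P, forall w, Y w = Z w}.
Proof.
move=> GT [GY Yi YE] [GZ Zi ZE].
have mY : measurable_fun (setT : set (g_sigma_algebraType G0)) Y.
  by move=> _ B mB; rewrite setTI; exact: GY.
have mZ : measurable_fun (setT : set (g_sigma_algebraType G0)) Z.
  by move=> _ B mB; rewrite setTI; exact: GZ.
pose A : set T := [set w | Y w <= Z w].
have GA : <<s G0 >> A.
  have := measurable_fun_ler mY mZ; move=> /(_ measurableT [set true] (ltac:(by []))).
  by rewrite setTI.
have GAC : <<s G0 >> (~` A).
  by rewrite -setTD; have [_ + _] := smallest_sigma_algebra [set: T] G0; apply.
have mA := GT _ GA; have mAC := GT _ GAC.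
have YZi : P.-integrable setT (EFin \o (fun w => Y w - Z w)) by exact: integrable_EFinB.
have zero B : measurable B -> <<s G0 >> B -> (\int[P]_(w in B) (Y w - Z w)%:E = 0)%E.
  move=> mB GB; under eq_integral do rewrite EFinB.
  have YiB : P.-integrable B (EFin \o Y) by exact: integrableS Yi.
  rewrite integralB_EFin//; last exact: integrableS Zi.
  rewrite YE// ZE// subee// -YE// -[X in X \is a fin_num]/(\int[P]_(w in B) ((EFin \o Y) w))%E.
  exact: integrable_fin_num.
have mYZ : measurable_fun setT (EFin \o (fun w => Y w - Z w)) by exact: measurable_int YZi.
have : (\int[P]_w `|(Y w - Z w)%:E| = 0)%E.
  rewrite -(setUv A) ge0_integral_setU//; last 2 first.
  - by rewrite setUv; exact: measurableT_comp.
  - exact/disj_setPCl.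
  rewrite (eq_integral (fun w => - (Y w - Z w)%:E)%E) => [|w /[!inE] Aw]; last first.
    by rewrite /= ler0_norm// subr_le0.
  rewrite integralN/=; last first.
    by apply: integrable_add_def => //; exact: (integrableS measurableT mA _ YZi).
  rewrite zero// oppe0 add0e (eq_integral (fun w => (Y w - Z w)%:E)) ?zero// => w /[!inE] /negP.
  by rewrite -ltNge => ZY; rewrite /= ger0_norm// subr_ge0 ltW.
move=> /(ae_eq_integral_abs P measurableT mYZ); apply: filterS => w /(_ I) /= [] /eqP.
by rewrite subr_eq0 => /eqP.
Qed.

End cond_exp_unique.

(** * Conditional expectations and Stein's step for the full series *)

Section clt.
Context d (T : measurableType d) (R : realType) (P : probability T R).
Variable X : nat -> {RV P >-> R}.
Hypothesis X_indep : independent_RVs X.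
Hypothesis X_mean0 : forall i, \int[P]_w X i w = 0.
Hypothesis X_sqr : forall i, P.-integrable setT (EFin \o (fun w => X i w ^+ 2)).
Variable V : R.
Hypothesis cvg_var : \sum_(0 <= i < n) \int[P]_w X i w ^+ 2 @[n --> \oo] --> V.
Local Notation integrable f := (P.-integrable setT (EFin \o f)).
Local Notation S n w := (\sum_(0 <= i < n) X i w).
Local Notation W := (fun w => limn (fun n => S n w)).
Local Notation W_except i := (fun w => limn (fun n => \sum_(0 <= k < n | k != i) X k w)).

(** All partial sums without index [i] depend on the other variables alone, so their limit does too,
    even where it is a default value. For [W - X i] this can be claimed only up to a null set. *)
Lemma limn_except_sigma_except i : sigma_except_fun X i (W_except i).
Proof.
apply: sigma_except_fun_meas; apply: measurable_limn => n.
rewrite [Y in measurable_fun _ Y](_ : _ =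
    (fun w => \sum_(k <- [seq k <- index_iota 0 n | k != i]) X k w)).
  by apply: measurable_sum_except; rewrite mem_filter eqxx.
by apply/funext => w; rewrite big_filter.
Qed.

Lemma limn_partial_sumE i : {ae P, forall w, W w = W_except i w + X i w}.
Proof.
apply: filterS (ae_cvg_partial_sum X_indep X_mean0 X_sqr cvg_var) => w cw.
have c : \sum_(0 <= k < n | k != i) X k w @[n --> \oo] --> W w - X i w.
  have : S n w - X i w @[n --> \oo] --> W w - X i w by apply: cvgB => //; exact: cvg_cst.
  apply: cvg_trans; apply: near_eq_cvg; near=> n.
  rewrite (bigD1_seq i) ?iota_uniq//=; first by rewrite addrAC subrr add0r.
  by rewrite mem_index_iota/=; near: n; exact: nbhs_infty_gt.
by rewrite (cvg_lim _ c)// subrK.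
Unshelve. all: by end_near. Qed.

Let mW : measurable_fun setT W.
Proof. exact: measurable_limn_partial_sum. Qed.

Let mWi i : measurable_fun setT (W_except i).
Proof. exact: sigma_except_funP (@limn_except_sigma_except i). Qed.

Let Wi : integrable W.
Proof. exact: integrable_limn_partial_sum cvg_var. Qed.

Let W_except_integrable i : integrable (W_except i).
Proof.
have Xi := X_integrable X_sqr i.
have : integrable (fun w => W w - X i w) by exact: integrable_EFinB.
move/integrableP => [_ WXoo]; apply/integrableP; split; first exact/measurable_EFinP.
apply: le_lt_trans WXoo; rewrite le_eqVlt; apply/orP; left; apply/eqP.
apply: ge0_ae_eq_integral => //.
- by apply: measurableT_comp => //; exact/measurable_EFinP.
- by apply: measurableT_comp => //; apply/measurable_EFinP; exact: measurable_funB.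
- by apply: filterS (limn_partial_sumE i) => w E _ /=; rewrite E addrK.
Qed.

(** The difference of the two functions is almost surely [c * X i], and a centred variable
    independent of the event [A] has integral 0 over [A]. *)
Lemma is_cond_exp_series c i :
  is_cond_exp P (sigma_except X i) (fun w => c * W w) (fun w => c * W_except i w).
Proof.
have Xi := X_integrable X_sqr i.
split.
- move=> B mB; rewrite (_ : _ @^-1` B = W_except i @^-1` ((fun x : R => c * x) @^-1` B))//.
  apply: limn_except_sigma_except; rewrite -[X in measurable X]setTI.
  exact: mulrl_measurable.
- exact: integrable_EFinZl.
- move=> A GA; have mA := sigma_except_measurable GA.
  have X0 : (\int[P]_(w in A) (X i w)%:E = 0)%E.
    rewrite integral_mkcond (eq_integral (fun w => (X i w * \1_A w)%:E)); last first.
      move=> w _; rewrite patchE indicE; case: ifP => _; first by rewrite mulr1.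
      by rewrite mulr0.
    have iA : integrable (\1_A : T -> R) by exact: integrable_indic.
    have GI : sigma_except_fun X i (\1_A : T -> R).
      by apply: sigma_except_fun_meas; exact: measurable_indic.
    have [XA _] := Rintegral_mul_sigma_except X_indep (@measurable_id _ _ setT) Xi GI iA.
    rewrite -[LHS]fineK; last exact: (integrable_fin_num measurableT XA).
    by congr EFin; exact: (Rintegral_mul_centered X_indep X_mean0 X_sqr GI iA).
  have mcW (Y : T -> R) : measurable_fun setT Y -> measurable_fun A (fun w => (c * Y w)%:E).
    by move=> mY; apply: measurable_funTS; apply/measurable_EFinP; exact: measurable_funM.
  transitivity (\int[P]_(w in A) (c * W_except i w + c * X i w)%:E)%E; last first.
    apply: ae_eq_integral => //; last 2 first.
    - exact: mcW.
    - by apply: filterS (limn_partial_sumE i) => w -> _; rewrite mulrDr.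
    under eq_fun do rewrite -mulrDr.
    by apply: mcW; exact: measurable_funD.
  under [RHS]eq_integral do rewrite EFinD.
  rewrite integralD//; last 2 first.
  - by apply: integrableS (integrable_EFinZl measurableT c (W_except_integrable i)).
  - by apply: integrableS (integrable_EFinZl measurableT c Xi).
  under [X in (_ + X)%E]eq_integral do rewrite EFinM.
  by rewrite integralZl ?X0 ?mule0 ?adde0//; exact: integrableS Xi.
Qed.

(** [is_cond_exp_series] exhibits a version, so [cond_exp] is a genuine version rather than the
    default 0, and almost sure uniqueness identifies the two. *)
Lemma frakD_series c i :
  measurable_fun setT (frakD P X i (fun w => c * W w)) /\
  {ae P, forall w, frakD P X i (fun w => c * W w) w = c * X i w}.
Proof.
have H := is_cond_exp_series c i.
pose Z := cond_exp P (sigma_except X i) (fun w => c * W w).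
have HZ : is_cond_exp P (sigma_except X i) (fun w => c * W w) Z.
  exact: (@xgetPex _ (cst 0) [set Y | is_cond_exp P (sigma_except X i) _ Y] (ex_intro _ _ H)).
have mZ : measurable_fun setT Z.
  by have [GZ _ _] := HZ; exact: (@sigma_except_funP _ _ _ _ X i Z).
split; first by apply: measurable_funB => //; exact: measurable_funM.
have ZE := is_cond_exp_ae_unique (@sigma_except_measurable _ _ _ _ X i) HZ H.
apply: filterS2 (limn_partial_sumE i) ZE => w WE ZE.
by rewrite /frakD -/Z ZE WE mulrDr addrAC subrr add0r.
Qed.

(** [stein_step] is summed over [i < n] with the full series kept inside [f], which compares
    [S n * f (c * W)] with the partial variance times [f']. Since [|f| <= 1], passing from [S n] to
    [W] costs at most [E |W - S n|], which vanishes in the limit; multiplying by [c] then turns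
    [c ^+ 2 * V] into 1. *)
Lemma stein_series (f f' : R -> R) (c b : R) :
    (forall x : R, is_derive x 1 f (f' x)) -> (forall x, `|f x| <= 1) ->
    (forall x, `|f' x| <= 4) -> (forall x y, `|f' x - f' y| <= 2 * `|x - y|) ->
    (forall i, integrable (fun w => `|X i w| ^+ 3)) ->
    (forall n, \sum_(0 <= i < n) \int[P]_w `|X i w| ^+ 3 <= b) ->
    0 <= c -> c ^+ 2 * V = 1 ->
  `|c * \int[P]_w (W w * f (c * W w)) - \int[P]_w f' (c * W w)| <= 4 * c ^+ 3 * b.
Proof.
move=> df f1 f'4 f'l X3 Xb c0 cV.
have mf : measurable_fun setT f.
  exact: continuous_measurable_fun (is_derive_continuous df).
have mf' : measurable_fun setT f'.
  exact: continuous_measurable_fun (klipschitz_continuous (ltr0Sn _ 1) f'l).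
have mcW : measurable_fun setT (fun w => c * W w) by exact: measurable_funM.
have mfW : measurable_fun setT (fun w => f (c * W w)) by exact: (measurableT_comp mf).
have mf'W : measurable_fun setT (fun w => f' (c * W w)) by exact: (measurableT_comp mf').
set q := \int[P]_w f' (c * W w); set p := \int[P]_w (W w * f (c * W w)).
have mulf (Y : T -> R) : integrable Y -> integrable (fun w => Y w * f (c * W w)).
  by move=> Yi; exact: (integrable_mul_bounded mfW (fun w => f1 (c * W w)) Yi).
have step i : `|\int[P]_w (X i w * f (c * W w)) - c * \int[P]_w X i w ^+ 2 * q| <=
    4 * c ^+ 2 * \int[P]_w `|X i w| ^+ 3.
  have := stein_step X_indep X_mean0 X_sqr X3 df f1 f'4 f'l c0 (@limn_except_sigma_except i).
  congr (`|_ - _ * _| <= _).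
    apply: ae_eq_Rintegral.
    - apply: measurable_funM => //; apply: (measurableT_comp mf); apply: measurable_funM => //.
      exact: measurable_funD.
    - exact: measurable_funM.
    - by apply: filterS (limn_partial_sumE i) => w ->.
  apply: ae_eq_Rintegral => //.
  - apply: (measurableT_comp mf'); apply: measurable_funM => //.
    exact: measurable_funD.
  - by apply: filterS (limn_partial_sumE i) => w ->.
have mS n : measurable_fun setT (fun w => S n w) by exact: measurable_partial_sum.
have Si n : integrable (fun w => S n w).
  by apply: integrable_EFin_sum => // i; exact: X_integrable.
have Sstep n : `|\int[P]_w (S n w * f (c * W w)) -
    c * (\sum_(0 <= i < n) \int[P]_w X i w ^+ 2) * q| <= 4 * c ^+ 2 * b.
  have -> : \int[P]_w (S n w * f (c * W w)) = \sum_(0 <= i < n) \int[P]_w (X i w * f (c * W w)).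
    rewrite -Rintegral_sum// => [|i]; last exact/mulf/X_integrable.
    by apply: eq_Rintegral => w _; rewrite mulr_suml.
  rewrite mulr_sumr mulr_suml -sumrB; apply: le_trans (ler_norm_sum _ _ _) _.
  apply: (@le_trans _ _ (\sum_(0 <= i < n) 4 * c ^+ 2 * \int[P]_w `|X i w| ^+ 3)).
    by apply: ler_sum => i _; exact: step.
  by rewrite -mulr_sumr ler_wpM2l// mulr_ge0// sqr_ge0.
have tail n e : 0 < e -> `|p - \int[P]_w (S n w * f (c * W w))| <=
    (V - \sum_(0 <= i < n) \int[P]_w X i w ^+ 2) / e + e.
  move=> e0; have WSi : integrable (fun w => W w - S n w) by exact: integrable_EFinB.
  rewrite -RintegralB//; [|exact: mulf|exact: mulf].
  apply: (@le_trans _ _ (\int[P]_w `|W w - S n w|)).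
    apply: le_trans (le_normr_Rintegral _ _) _ => //.
      by apply: integrable_EFinB => //; exact: mulf.
    apply: le_Rintegral => //; last 2 first.
    - exact: integrable_norm.
    - by move=> w _; rewrite -mulrBl normrM ler_piMr.
    by apply: integrable_norm; apply: integrable_EFinB => //; exact: mulf.
  rewrite -lee_fin /Rintegral fineK; last first.
    by apply: integrable_fin_num => //; exact: integrable_norm.
  exact: (integral_limn_sub_partial_sum X_indep X_mean0 X_sqr cvg_var n e0).
have cq : c * (\sum_(0 <= i < n) \int[P]_w X i w ^+ 2) * q @[n --> \oo] --> c * V * q.
  apply: cvgM; last exact: cvg_cst.
  apply: cvgM; first exact: cvg_cst.
  exact: cvg_var.
(* The limit in [n] is taken for fixed [e], where the tail term becomes [(V - V) / e]; only then is
   [e] let go to 0. *)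
have lim_le e : 0 < e -> `|p - c * V * q| <= (V - V) / e + e + 4 * c ^+ 2 * b.
  move=> e0.
  apply: (@ler_cvg_to _ \oo _ _
    (fun n => `|p - c * (\sum_(0 <= i < n) \int[P]_w X i w ^+ 2) * q|)
    (fun n => (V - \sum_(0 <= i < n) \int[P]_w X i w ^+ 2) / e + e + 4 * c ^+ 2 * b)).
  - apply: cvg_norm; apply: cvgB; first exact: cvg_cst.
    exact: cq.
  - apply: cvgD; last exact: cvg_cst.
    apply: cvgD; last exact: cvg_cst.
    exact: (cvgM (cvgB (cvg_cst V) cvg_var) (cvg_cst e^-1)).
  - apply: nearW => n; rewrite -[X in `|X - _|](subrK (\int[P]_w (S n w * f (c * W w)))) -addrA.
    by apply: le_trans (ler_normD _ _) _; apply: lerD; [exact: tail|exact: Sstep].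
have {lim_le} lim_le : `|p - c * V * q| <= 4 * c ^+ 2 * b.
  apply/ler_addgt0Pr => e e0; have := lim_le e e0.
  by rewrite subrr mul0r add0r (addrC e).
have -> : c * p - q = c * (p - c * V * q) by rewrite mulrBr !mulrA -expr2 cV mul1r.
rewrite normrM (ger0_norm c0) (_ : 4 * c ^+ 3 * b = c * (4 * c ^+ 2 * b)); last by ring.
by rewrite ler_wpM2l.
Qed.

End clt.

Local Open Scope ereal_scope.

Lemma integrable_nonneg d (T : measurableType d) (R : realType)
    (P : {measure set T -> \bar R}) (f : T -> R) :
  measurable_fun setT f -> (forall w, 0 <= f w)%R ->
  \int[P]_w (f w)%:E < +oo -> P.-integrable setT (EFin \o f).
Proof.
move=> mf f0 foo; apply/integrableP; split; first exact/measurable_EFinP.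
by under eq_integral do rewrite /= ger0_norm//.
Qed.

Lemma expectationE d (T : measurableType d) (R : realType)
    (P : probability T R) (f : T -> R) :
  P.-integrable setT (EFin \o f) -> 'E_P[f] = (\int[P]_w f w)%R%:E.
Proof. by move=> fi; rewrite unlock /Rintegral fineK ?integrable_fin_num. Qed.

Theorem theorem3p2 (R : realType)
    (d : measure_display) (T : measurableType d) (P : probability T R)
    (d' : measure_display) (T' : measurableType d') (P' : probability T' R)
    (N : {RV P' >-> R})
    (N_normal : forall A : set R, measurable A ->
       distribution P' N A = normal_prob 0%R 1%R A)
    (X : nat -> {RV P >-> R})
    (X_indep : independent_RVs X)
    (X_mean0 : forall i, 'E_P[X i] = 0)
    (X_var_fin : forall i, 'E_P[fun w => (X i w ^+ 2)%R] < +oo)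
    (Sigma_pos : 0 < Sigma_oo P X)
    (Sigma_fin : Sigma_oo P X < +oo)
    (X_third_fin : forall i, 'E_P[fun w => (`|X i w| ^+ 3)%R] < +oo) :
  wasserstein P P' (S_oo P X) N <= 4%:E * calL P X 3%R (S_oo P X) /\
  4%:E * calL P X 3%R (S_oo P X) =
    4%:E * (fine (Sigma_oo P X) `^ (- (3 / 2)))%:E
    * \sum_(0 <= i <oo) 'E_P[fun w => (`|X i w| ^+ 3)%R].
Proof.
have X_sqr i : P.-integrable setT (EFin \o (fun w => X i w ^+ 2)%R).
  apply: integrable_nonneg; first exact: measurable_funX.
    by move=> w; rewrite sqr_ge0.
  by have := X_var_fin i; rewrite unlock.
have X_cube i : P.-integrable setT (EFin \o (fun w => `|X i w| ^+ 3)%R).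
  apply: integrable_nonneg.
  - by apply: measurable_funX; exact: measurableT_comp.
  - by move=> w; rewrite exprn_ge0.
  - by have := X_third_fin i; rewrite unlock.
have X_mean i : (\int[P]_w X i w = 0)%R.
  by have := X_mean0 i; rewrite unlock /Rintegral => ->.
pose v i := (\int[P]_w X i w ^+ 2)%R; pose b i := (\int[P]_w `|X i w| ^+ 3)%R.
have v0 i : (0 <= v i)%R by apply: Rintegral_ge0 => w _; rewrite sqr_ge0.
have b0 i : (0 <= b i)%R by apply: Rintegral_ge0 => w _; rewrite exprn_ge0.
have SigmaE : Sigma_oo P X = \sum_(0 <= i <oo) (v i)%:E.
  by apply: eq_eseriesr => i _; rewrite expectationE.
pose V := fine (Sigma_oo P X).
have VE : V%:E = Sigma_oo P X by rewrite fineK// ge0_fin_numE// ltW.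
have V0 : (0 < V)%R by rewrite -lte_fin VE.
have cvg_var : (\sum_(0 <= i < n) \int[P]_w X i w ^+ 2)%R @[n --> \oo] --> V.
  have : (\sum_(0 <= i < n) (v i)%:E) @[n --> \oo] --> V%:E.
    rewrite VE SigmaE; apply: is_cvg_nneseries => i _ _; by rewrite lee_fin.
  by under eq_fun do rewrite sumEFin; move/fine_cvgP => [_].
pose c := (V `^ (- (1 / 2)))%R.
have c0 : (0 < c)%R by rewrite powR_gt0.
have cV : (c ^+ 2 * V = 1)%R.
  rewrite -powR_mulrn ?ltW// /c -powRrM mulNr divfK ?pnatr_eq0// powRN powRr1 ?ltW//.
  by rewrite mulVf// gt_eqF.
have c3 : (c ^+ 3 = V `^ (- (3 / 2)))%R.
  by rewrite -powR_mulrn ?ltW// /c -powRrM; congr (_ `^ _)%R; field.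
have S_ooE : S_oo P X = (fun w => c * limn (fun n => \sum_(0 <= i < n) X i w))%R by [].
(* Each [frakD] is [c * X i] almost surely, so each term is [c ^+ 3] times the third moment. *)
have calLE : calL P X 3%R (S_oo P X) = (c ^+ 3)%:E * \sum_(0 <= i <oo) (b i)%:E.
  rewrite /calL -nneseriesZl; last by move=> i _; rewrite lee_fin.
  apply: eq_eseriesr => i _.
  have [mD DE] := frakD_series X_indep X_mean X_sqr cvg_var c i.
  rewrite S_ooE unlock; under eq_integral do rewrite powR_mulrn//.
  rewrite -EFinM -RintegralZl// /Rintegral fineK; last first.
    by apply: integrable_fin_num => //; exact: integrable_EFinZl.
  apply: ae_eq_integral => //.
  - by apply/measurable_EFinP; apply: measurable_funX; exact: measurableT_comp.
  - apply/measurable_EFinP; apply: measurable_funM => //; apply: measurable_funX.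
    exact: measurableT_comp.
  - apply: filterS DE => w -> _; congr EFin.
    by rewrite normrM (ger0_norm (ltW c0)) exprMn.
have cubeE : \sum_(0 <= i <oo) 'E_P[fun w => (`|X i w| ^+ 3)%R] = \sum_(0 <= i <oo) (b i)%:E.
  by apply: eq_eseriesr => i _; rewrite expectationE.
split; last by rewrite calLE cubeE -/V -c3 muleA.
rewrite calLE; apply: ge_ereal_sup => _ [h hl <-].
(* If the third moments are not summable, the right-hand side is [+oo], as [c > 0], and the bound is
   trivial. *)
have [boo|boo] := eqVneq (\sum_(0 <= i <oo) (b i)%:E) +oo.
  by rewrite boo muleA -EFinM gt0_muley ?leey// lte_fin mulr_gt0// exprn_gt0.
have bfin : \sum_(0 <= i <oo) (b i)%:E \is a fin_num.
  by rewrite ge0_fin_numE ?ltey//; apply: nneseries_ge0 => i _ _; rewrite lee_fin.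
pose B := fine (\sum_(0 <= i <oo) (b i)%:E).
rewrite -[\sum_(0 <= i <oo) _]fineK// -/B.
have bB n : (\sum_(0 <= i < n) b i <= B)%R.
  rewrite -lee_fin /B fineK// -sumEFin.
  by apply: nneseries_lim_ge => i _ _; rewrite lee_fin.
have hi := lipschitz1_mul_normal01_integrable hl.
have mh : measurable_fun setT h.
  by apply: continuous_measurable_fun; exact: lipschitz1_continuous.
rewrite (expectation_normal01 N_normal mh hi).
have [f [f' [df f1 f'4 f'l fE] ] ] := stein_equation hl (erefl _).
set m := (\int[lebesgue_measure]_t _)%R in fE *.
pose W w := (limn (fun n => \sum_(0 <= i < n) X i w))%R.
have SW : (`|c * \int[P]_w (W w * f (c * W w)) - \int[P]_w f' (c * W w)| <= 4 * c ^+ 3 * B)%R.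
  exact: (stein_series X_indep X_mean X_sqr cvg_var df f1 f'4 f'l X_cube bB (ltW c0) cV).
have Wi : P.-integrable setT (EFin \o W) by exact: integrable_limn_partial_sum cvg_var.
have mW : measurable_fun setT W by exact: measurable_limn_partial_sum.
have mcW : measurable_fun setT (fun w => c * W w)%R by exact: measurable_funM.
have mf : measurable_fun setT f.
  exact: continuous_measurable_fun (is_derive_continuous df).
have mfW : measurable_fun setT (fun w => f (c * W w))%R by exact: (measurableT_comp mf).
have Wfi : P.-integrable setT (EFin \o (fun w => W w * f (c * W w))%R).
  exact: (integrable_mul_bounded mfW (fun w => f1 (c * W w)%R) Wi).
have cWfi : P.-integrable setT (EFin \o (fun w => c * (W w * f (c * W w)))%R).
  exact: integrable_EFinZl.
have f'E x : (f' x = h x - m + x * f x)%R by rewrite -fE subrK.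
have mf' : measurable_fun setT f'.
  rewrite (_ : f' = (fun x => h x - m + x * f x)%R); last exact/funext.
  by apply: measurable_funD; [exact: measurable_funB|exact: measurable_funM].
have f'i : P.-integrable setT (EFin \o (fun w => f' (c * W w))%R).
  apply: (@le_integrable_EFin _ _ _ _ _ measurableT _ (fun=> 4%R)) => //.
  - exact: (measurableT_comp mf').
  - exact: integrable_cst_prob.
have i1 : P.-integrable setT (EFin \o (fun w => f' (c * W w) - c * (W w * f (c * W w)))%R).
  exact: integrable_EFinB.
(* Stein's equation at [S], solved for [h]: subtracting the Gaussian mean [m] leaves exactly the
   difference that [stein_series] bounds. *)
have hE w : (h (S_oo P X w) = f' (c * W w) - c * (W w * f (c * W w)) + m)%R.
  by rewrite S_ooE f'E mulrA addrK subrK.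
have hi' : P.-integrable setT (EFin \o (h \o S_oo P X)).
  rewrite (_ : h \o S_oo P X = fun w => f' (c * W w) - c * (W w * f (c * W w)) + m)%R.
    by apply: integrable_EFinD => //; exact: integrable_cst_prob.
  by apply/funext => w /=; rewrite hE.
rewrite expectationE// -EFinB -!EFinM lee_fin mulrA distrC.
have -> : (\int[P]_w (h \o S_oo P X) w =
    \int[P]_w f' (c * W w) - c * \int[P]_w (W w * f (c * W w)) + m)%R.
  transitivity (\int[P]_w (f' (c * W w) - c * (W w * f (c * W w)) + m))%R.
    by apply: eq_Rintegral => w _ /=; rewrite hE.
  rewrite RintegralD//; last exact: integrable_cst_prob.
  by rewrite RintegralB// RintegralZl// Rintegral_cst_prob.
by rewrite opprD opprB addrCA subrr addr0.
Qed.
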